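(* Let $P\in\mathfrak{X}_{(1,0)}(\mathcal{B}_{\mathbf{Q}})$ be the diffeomorphism BRST operator and $Q\in\mathfrak{X}_{(0,1)}(\mathcal{B}_{\mathbf{Q}})$ the gauge BRST operator. Then $$[P,Q]\equiv P\circ Q+Q\circ P\equiv 0 ,$$ i.e. their sum $D:=P+Q$ is also a cohomological vector field with respect to the total ghost degree: $D\in\mathfrak{X}_{(1)}(\mathcal{B}_{\mathbf{Q}})$ and $$[D,D]\equiv 2D^2\equiv 0 .$$ ($D$ is called the total BRST operator.)
   Context: Setting. $(M,g)$ is a spacetime (smooth, connected, time-orientable Lorentzian manifold) with metric decomposition $g_{\mu\nu}=\eta_{\mu\nu}+\varkappa h_{\mu\nu}$, where $\eta$ is the Minkowski background metric, $h$ the graviton field and $\varkappa$ the graviton coupling constant. $G\cong U(1)\times\widetilde G$ (with $\widetilde G$ a compact semisimple Lie group) is the gauge group, $\mathfrak g$ its Lie algebra with structure constants $f^a{}_{bc}$, $\mathrm g$ the gauge coupling constant. $\zeta,\xi$ are the gauge fixing parameters. The fields are sections of the globally trivial $\mathbb{Z}^2$-graded super bundle $\mathcal{B}_{\mathbf{Q}}\to M$; with bidegree (graviton-ghost degree, gauge ghost degree) they are: $h_{\mu\nu}$, vielbein $e$, gauge boson $A^a_\mu$, Higgs/Goldstone vector $\Phi$, fermion vector $\Psi$, auxiliary (Lautrup–Nakanishi) fields $B^\rho$ and $b_a$, all of degree $(0,0)$; graviton-ghost $C_\rho$ of degree $(1,0)$; graviton-antighost $\overline C^\rho$ of degree $(-1,0)$;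 gauge ghost $c^a$ of degree $(0,1)$; gauge antighost $\overline c_a$ of degree $(0,-1)$. The total ghost degree is the sum $i+j$ and parity is $i+j$ mod 2 (odd ghosts anticommute). Spacetime indices are raised and lowered with metrics in ghost degree zero, gauge indices with $\delta_{ab}$. $\mathfrak{X}_{(i,j)}(\mathcal{B}_{\mathbf{Q}})$ (resp. $\mathfrak{X}_{(k)}$) denotes super vector fields of bidegree $(i,j)$ (resp. total degree $k$); they act as superderivations on the superalgebra $\mathcal{C}_{\mathbf{Q}}$ of graded-symmetric polynomial functionals of the fields and their derivatives. The supercommutator is $[X_1,X_2]=X_1X_2-(-1)^{p_1p_2}X_2X_1$. An odd vector field $\Xi$ with $[\Xi,\Xi]=2\Xi^2=0$ is called cohomological if it has degree $1$ and homological if it has degree $-1$. Diffeomorphism BRST operator $P$ (commuting with $\partial_\mu$): with $\Gamma^\rho{}_{\mu\nu}=\frac12 g^{\rho\sigma}(\partial_\mu g_{\sigma\nu}+\partial_\nu g_{\mu\sigma}-\partial_\sigma g_{\mu\nu})$, $Ph_{\mu\nu}=\frac1\zeta\partial_\mu C_\nu+\frac1\zeta\partial_\nu C_\mu-2C_\rho\Gamma^\rho{}_{\mu\nu}$; $PC_\rho=\varkappa C^\sigma(\partial_\sigma C_\rho)$; $P\overline C^\rho=\frac1\zeta B^\rho$; $PB^\rho=0$; $P\eta_{\mu\nu}=0$; $P\delta_{ab}=0$; $PA^a_\mu=\varkappa\big(C^\rho(\partial_\rho A^a_\mu)+(\partial_\mu C^\rho)A^a_\rho\big)$; $Pc^a=\varkappa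 C^\rho(\partial_\rho c^a)$; $P\overline c_a=\varkappa C^\rho(\partial_\rho\overline c_a)$; $Pb_a=\varkappa C^\rho(\partial_\rho b_a)$; $P\Phi=\varkappa C^\rho(\partial_\rho\Phi)$; $P\Psi=\varkappa\big(C^\rho\nabla^{\Sigma M}_\rho\Psi+\frac{\mathrm i}{4}(\partial_\mu C_\nu-\partial_\nu C_\mu)e^{\mu m}e^{\nu n}\boldsymbol{\sigma}_{mn}\Psi\big)$ (Kosmann's Lie derivative of spinors; $\nabla^{\Sigma M}$ is the covariant derivative on the twisted spinor bundle). On all fields $\varphi\notin\{h,C,\overline C,B,\eta\}$, $P\varphi=\varkappa\mathcal{L}_C\varphi$ is $\varkappa$ times the Lie derivative along $C$. Gauge BRST operator $Q$ (commuting with $\partial_\mu$): $QA^a_\mu=\frac1\xi\partial_\mu c^a+\mathrm g f^a{}_{bc}c^bA^c_\mu$; $Qc^a=\frac{\mathrm g}{2}f^a{}_{bc}c^bc^c$; $Q\overline c_a=\frac1\xi b_a$; $Qb_a=0$; $Q\delta_{ab}=0$; $Qh=QC=Q\overline C=QB=Q\eta=Q\Gamma=0$; $Q\Phi=\mathrm g c^a(\mathfrak H_a\cdot\Phi)$; $Q\Psi=\mathrm g c^a(\mathfrak S_a\cdot\Psi)$, where $\mathfrak H_a,\mathfrak S_a$ are the infinitesimal actions of the gauge group on the Higgs bundle and on the twisted spinor bundle.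
   Formalization: D²=0 is proved only if P²=0 (unconditionally: [P,Q]=0 and D²=P²), as the printed formulas give P²h≠0 when ϰ≠0; in PΨ the covariant derivative is the spin connection without the gauge connection, which would make [P,Q]Ψ≠0. *)

(* Defs.v *)
From HB Require Import structures.
From mathcomp Require Import all_boot all_order all_algebra.
From mathcomp Require Import complex.
From mathcomp Require Import boolp reals.

Set Implicit Arguments.
Unset Strict Implicit.
Unset Printing Implicit Defensive.

Import Order.TTheory GRing.Theory Num.Theory.
Local Open Scope ring_scope.
Local Open Scope complex_scope.
Local Open Scope quotient_scope.

(** * Data of the theory *)

(* Minkowski metric in inertial coordinates, signature (+,-,-,-). *)
Definition eta {K : pzRingType} (mu nu : 'I_4) : K :=
  if mu == nu then (if mu == ord0 then 1 else -1) else 0.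

Definition mxcomm {K : pzRingType} {n : nat} (M N : 'M[K]_n) : 'M[K]_n :=
  M *m N - N *m M.

(* sigma_mn = (i/4) [gamma_m, gamma_n]: the normalisation for which the term
   (i/4) (d_mu C_nu - d_nu C_mu) e^{mu m} e^{nu n} sigma_mn is exactly the one
   in Kosmann's Lie derivative of spinors. *)
Definition spin_generator {R : realType} {n : nat} (gamma : 'I_4 -> 'M[R[i]]_n)
    (m k : 'I_4) : 'M[R[i]]_n :=
  ('i / 4) *: mxcomm (gamma m) (gamma k).

Definition killing_form {K : pzRingType} {n : nat}
    (f : 'I_n -> 'I_n -> 'I_n -> K) (x y : 'rV[K]_n) : K :=
  \sum_a \sum_b \sum_c \sum_d x 0 a * y 0 b * f c a d * f d b c.

(* Couplings, gauge fixing parameters, the gauge Lie algebra with its structure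
   constants [str a b c] = f^a_{bc}, and its infinitesimal actions on the Higgs
   bundle and on the twisted spinor bundle.  The basis of the Lie algebra of
   U(1) x G~ is indexed by 'I_n.+1, with ord0 spanning u(1); G~ is compact
   semisimple, i.e. the Killing form is negative definite on its Lie algebra.
   The gauge action on twisted spinors commutes with the spin generators; it is
   not required to commute with the gamma_m, so chiral couplings are allowed. *)
Record model (R : realType) := Model {
  kappa : R;
  gcoup : R;
  zeta : R;
  xi : R;
  zeta_neq0 : zeta != 0;
  xi_neq0 : xi != 0;
  gdim : nat;
  str : 'I_gdim.+1 -> 'I_gdim.+1 -> 'I_gdim.+1 -> R;
  str_anti : forall a b c, str a b c = - str a c b;
  str_jacobi : forall e a b c,
    \sum_d (str e a d * str d b c + str e b d * str d c a
            + str e c d * str d a b) = 0;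
  str_u1 : forall a b c, (a == ord0) || (b == ord0) -> str a b c = 0;
  str_compact : forall x : 'rV[R]_gdim.+1,
    x 0 ord0 = 0 -> x != 0 -> killing_form str x x < 0;
  higgs_dim : nat;
  higgs_rep : 'I_gdim.+1 -> 'M[R[i]]_higgs_dim;
  higgs_repP : forall b c,
    mxcomm (higgs_rep b) (higgs_rep c) = \sum_a (str a b c)%:C *: higgs_rep a;
  spinor_dim : nat;
  gamma : 'I_4 -> 'M[R[i]]_spinor_dim;
  clifford : forall m n,
    gamma m *m gamma n + gamma n *m gamma m = (2 * eta m n)%:M;
  spinor_rep : 'I_gdim.+1 -> 'M[R[i]]_spinor_dim;
  spinor_repP : forall b c,
    mxcomm (spinor_rep b) (spinor_rep c)
    = \sum_a (str a b c)%:C *: spinor_rep a;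
  spinor_rep_spin : forall a m n,
    mxcomm (spinor_rep a) (spin_generator gamma m n) = 0
}.

(** * The superalgebra of the fields and their derivatives *)

(* Components of the fields.  [Fginv] is not a further field: it is the inverse
   metric g^{mu nu}, which is not polynomial in h and is therefore adjoined as a
   generator subject to the relation g^{mu rho} g_{rho nu} = delta.  Index
   positions: [Fe mu m] = e_mu^m, [FA a mu] = A^a_mu, [FB rho] = B^rho,
   [Fb a] = b_a, [FC rho] = C_rho, [FCbar rho] = \bar C^rho.  The vielbein is an
   independent field: no relation e_mu^m e_nu^n eta_mn = g_{mu nu} is imposed,
   since P (below) does not preserve it unless zeta = 1. *)
Inductive field_component (R : realType) (T : model R) : Type :=
  | Fh of 'I_4 & 'I_4
  | Fginv of 'I_4 & 'I_4
  | Fe of 'I_4 & 'I_4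
  | FA of 'I_(gdim T).+1 & 'I_4
  | FPhi of 'I_(higgs_dim T)
  | FPsi of 'I_(spinor_dim T)
  | FB of 'I_4
  | Fb of 'I_(gdim T).+1
  | FC of 'I_4
  | FCbar of 'I_4
  | Fc of 'I_(gdim T).+1
  | Fcbar of 'I_(gdim T).+1.

(* (graviton-ghost degree, gauge-ghost degree).  Parity is the total ghost
   degree, so Phi and Psi are even like all other fields of degree (0,0). *)
Definition ghost_degree (R : realType) (T : model R) (x : field_component T) : int * int :=
  match x with
  | FC _ => (1, 0)
  | FCbar _ => (-1, 0)
  | Fc _ => (0, 1)
  | Fcbar _ => (0, -1)
  | _ => (0, 0)
  end.

(* Differential polynomials in non-commuting field symbols. *)
Inductive term (R : realType) (T : model R) : Type :=
  | Tconst of R[i]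
  | Tfield of field_component T
  | Tadd of term T & term T
  | Tmul of term T & term T
  | Tder of 'I_4 & term T.

Arguments Tconst {R T}.

Inductive homogeneous (R : realType) (T : model R) : term T -> int -> int -> Prop :=
  | hom_zero i j : homogeneous (Tconst 0) i j
  | hom_const z : homogeneous (Tconst z) 0 0
  | hom_field x :
      homogeneous (Tfield x) (ghost_degree x).1 (ghost_degree x).2
  | hom_add s t i j :
      homogeneous s i j -> homogeneous t i j -> homogeneous (Tadd s t) i j
  | hom_mul s t i j k l :
      homogeneous s i j -> homogeneous t k l ->
      homogeneous (Tmul s t) (i + k) (j + l)
  | hom_der mu t i j : homogeneous t i j -> homogeneous (Tder mu t) i j.

Definition sgn {K : pzRingType} (d : int) : K := (-1) ^+ `|d|%N.

Definition Tmetric (R : realType) (T : model R) (mu nu : 'I_4) : term T :=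
  Tadd (Tconst (eta mu nu)) (Tmul (Tconst (kappa T)%:C) (Tfield (Fh T mu nu))).

(* The smallest congruence making terms an associative unital supercommutative
   algebra with commuting derivations d_mu, in which h_{mu nu} and g^{mu nu} are
   symmetric and g^{mu nu} is inverse to g_{mu nu} = eta_{mu nu} + kappa
   h_{mu nu}. *)
Inductive equal_terms (R : realType) (T : model R) : term T -> term T -> Prop :=
  | et_refl t : equal_terms t t
  | et_sym s t : equal_terms s t -> equal_terms t s
  | et_trans s t u : equal_terms s t -> equal_terms t u -> equal_terms s u
  | et_add s s' t t' : equal_terms s s' -> equal_terms t t' ->
      equal_terms (Tadd s t) (Tadd s' t')
  | et_mul s s' t t' : equal_terms s s' -> equal_terms t t' ->
      equal_terms (Tmul s t) (Tmul s' t')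
  | et_der mu t t' : equal_terms t t' -> equal_terms (Tder mu t) (Tder mu t')
  | et_addA s t u : equal_terms (Tadd s (Tadd t u)) (Tadd (Tadd s t) u)
  | et_addC s t : equal_terms (Tadd s t) (Tadd t s)
  | et_add0 t : equal_terms (Tadd (Tconst 0) t) t
  | et_addN t : equal_terms (Tadd (Tmul (Tconst (-1)) t) t) (Tconst 0)
  | et_mulA s t u : equal_terms (Tmul s (Tmul t u)) (Tmul (Tmul s t) u)
  | et_mul1 t : equal_terms (Tmul (Tconst 1) t) t
  | et_mulDl s t u :
      equal_terms (Tmul (Tadd s t) u) (Tadd (Tmul s u) (Tmul t u))
  | et_mulDr s t u :
      equal_terms (Tmul s (Tadd t u)) (Tadd (Tmul s t) (Tmul s u))
  | et_constD w z : equal_terms (Tconst (w + z)) (Tadd (Tconst w) (Tconst z))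
  | et_constM w z : equal_terms (Tconst (w * z)) (Tmul (Tconst w) (Tconst z))
  | et_supercomm s t i j k l : homogeneous s i j -> homogeneous t k l ->
      equal_terms (Tmul s t)
        (Tmul (Tconst (sgn ((i + j) * (k + l)))) (Tmul t s))
  | et_derD mu s t :
      equal_terms (Tder mu (Tadd s t)) (Tadd (Tder mu s) (Tder mu t))
  | et_derM mu s t : equal_terms (Tder mu (Tmul s t))
      (Tadd (Tmul (Tder mu s) t) (Tmul s (Tder mu t)))
  | et_der_const mu z : equal_terms (Tder mu (Tconst z)) (Tconst 0)
  | et_derC mu nu t :
      equal_terms (Tder mu (Tder nu t)) (Tder nu (Tder mu t))
  | et_h_sym mu nu : equal_terms (Tfield (Fh T mu nu)) (Tfield (Fh T nu mu))
  | et_ginv_sym mu nu :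
      equal_terms (Tfield (Fginv T mu nu)) (Tfield (Fginv T nu mu))
  | et_ginv mu nu : equal_terms
      (\big[@Tadd R T/Tconst 0]_(rho < 4)
          Tmul (Tfield (Fginv T mu rho)) (Tmetric T rho nu))
      (Tconst (mu == nu)%:R).

Section Algebra.
Context {R : realType} (T : model R).

HB.instance Definition _ := gen_eqMixin (term T).
HB.instance Definition _ := gen_choiceMixin (term T).

Definition equal_termsb (s t : term T) : bool := `[< equal_terms s t >].

Lemma equal_termsb_refl : reflexive equal_termsb.
Proof. by move=> t; apply/asboolP; exact: et_refl. Qed.

Lemma equal_termsb_sym : symmetric equal_termsb.
Proof.
by move=> s t; apply/asboolP/asboolP; exact: et_sym.
Qed.

Lemma equal_termsb_trans : transitive equal_termsb.
Proof.
move=> t s u /asboolP st /asboolP tu; apply/asboolP; exact: et_trans st tu.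
Qed.

Canonical equal_terms_equiv :=
  EquivRel equal_termsb equal_termsb_refl equal_termsb_sym equal_termsb_trans.

(* The superalgebra C_Q. *)
Definition functional := {eq_quot equal_termsb}.

HB.instance Definition _ := Choice.on functional.
HB.instance Definition _ := EqQuotient.on functional.

Local Notation cls := (\pi_functional).

Lemma clsP s t : equal_terms s t <-> cls s = cls t.
Proof.
split=> [st|/eqquotP/asboolP //]; by apply/eqquotP/asboolP.
Qed.

Lemma repr_cls t : equal_terms (repr (cls t)) t.
Proof. by apply/clsP; rewrite reprK. Qed.

Definition fadd (x y : functional) : functional := cls (Tadd (repr x) (repr y)).
Definition fmul (x y : functional) : functional := cls (Tmul (repr x) (repr y)).
Definition fconst (z : R[i]) : functional := cls (Tconst z).
Definition fopp (x : functional) : functional := fmul (fconst (-1)) x.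
Definition fscale (z : R[i]) (x : functional) : functional := fmul (fconst z) x.

(* The partial derivative d_mu. *)
Definition fder (mu : 'I_4) (x : functional) : functional :=
  cls (Tder mu (repr x)).

Lemma cls_add s t : cls (Tadd s t) = fadd (cls s) (cls t).
Proof. by apply/clsP/et_sym/et_add; exact: repr_cls. Qed.

Lemma cls_mul s t : cls (Tmul s t) = fmul (cls s) (cls t).
Proof. by apply/clsP/et_sym/et_mul; exact: repr_cls. Qed.

Lemma cls_der mu t : cls (Tder mu t) = fder mu (cls t).
Proof. by apply/clsP/et_sym/et_der; exact: repr_cls. Qed.

Lemma cls_ind (Pr : functional -> Prop) : (forall t, Pr (cls t)) -> forall x, Pr x.
Proof. by move=> Prc x; rewrite -[x]reprK. Qed.

Lemma faddA : associative fadd.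
Proof.
elim/cls_ind=> s; elim/cls_ind=> t; elim/cls_ind=> u.
by rewrite -!cls_add; apply/clsP/et_addA.
Qed.

Lemma faddC : commutative fadd.
Proof.
elim/cls_ind=> s; elim/cls_ind=> t.
by rewrite -!cls_add; apply/clsP/et_addC.
Qed.

Lemma fadd0 : left_id (fconst 0) fadd.
Proof. by elim/cls_ind=> t; rewrite -!cls_add; apply/clsP/et_add0. Qed.

Lemma faddN : left_inverse (fconst 0) fopp fadd.
Proof.
by elim/cls_ind=> t; rewrite /fopp -cls_mul -!cls_add; apply/clsP/et_addN.
Qed.

HB.instance Definition _ :=
  GRing.isZmodule.Build functional faddA faddC fadd0 faddN.

Lemma fmulA : associative fmul.
Proof.
elim/cls_ind=> s; elim/cls_ind=> t; elim/cls_ind=> u.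
by rewrite -!cls_mul; apply/clsP/et_mulA.
Qed.

Lemma fmul1 : left_id (fconst 1) fmul.
Proof. by elim/cls_ind=> t; rewrite -!cls_mul; apply/clsP/et_mul1. Qed.

Lemma homogeneous_supercomm s t i j k l :
  homogeneous s i j -> homogeneous t k l ->
  fmul (cls s) (cls t)
  = fmul (fconst (sgn ((i + j) * (k + l)))) (fmul (cls t) (cls s)).
Proof.
by move=> hs ht; rewrite -!cls_mul; apply/clsP/et_supercomm.
Qed.

Lemma fmulDl : left_distributive fmul fadd.
Proof.
elim/cls_ind=> s; elim/cls_ind=> t; elim/cls_ind=> u.
by rewrite -!(cls_mul, cls_add); apply/clsP/et_mulDl.
Qed.

Lemma fmulDr : right_distributive fmul fadd.
Proof.
elim/cls_ind=> s; elim/cls_ind=> t; elim/cls_ind=> u.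
by rewrite -!(cls_mul, cls_add); apply/clsP/et_mulDr.
Qed.

Lemma fconstD w z : fconst (w + z) = fadd (fconst w) (fconst z).
Proof. by rewrite -cls_add; apply/clsP/et_constD. Qed.

Lemma fconstM w z : fconst (w * z) = fmul (fconst w) (fconst z).
Proof. by rewrite -cls_mul; apply/clsP/et_constM. Qed.

Lemma fconst_central z x : fmul (fconst z) x = fmul x (fconst z).
Proof.
elim/cls_ind: x => t; elim: t => [w|x|s IHs t IHt|s IHs t IHt|mu t IHt].
- by rewrite -!fconstM mulrC.
- rewrite (homogeneous_supercomm (hom_const T z) (hom_field x)).
  by rewrite addr0 mul0r /sgn absz0 expr0 fmul1.
- by rewrite cls_add fmulDl fmulDr IHs IHt.
- by rewrite cls_mul fmulA IHs -fmulA IHt fmulA.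
- have -> : cls (Tder mu t) = fder mu (cls t) by rewrite cls_der.
  have dM a b : fder mu (fmul (cls a) (cls b))
      = fadd (fmul (fder mu (cls a)) (cls b)) (fmul (cls a) (fder mu (cls b))).
    by rewrite -!(cls_mul, cls_der, cls_add); apply/clsP/et_derM.
  have d0 : fder mu (fconst z) = 0 by rewrite -cls_der; apply/clsP/et_der_const.
  have f0 y : fmul 0 y = 0.
    have e : fmul (0 + 0) y = fmul 0 y + fmul 0 y := fmulDl 0 0 y.
    rewrite addr0 in e.
    by apply: (addrI (fmul 0 y)); rewrite addr0 [RHS]e.
  have f0r y : fmul y 0 = 0.
    have e : fmul y (0 + 0) = fmul y 0 + fmul y 0 := fmulDr y 0 0.
    rewrite addr0 in e.
    by apply: (addrI (fmul y 0)); rewrite addr0 [RHS]e.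
  move/(congr1 (fder mu)): IHt; rewrite !dM d0 f0 f0r.
  have a0 y : fadd 0 y = y := add0r y.
  have a0r y : fadd y 0 = y := addr0 y.
  by rewrite a0 a0r.
Qed.

Lemma fmul1r : right_id (fconst 1) fmul.
Proof. by move=> x; rewrite -fconst_central fmul1. Qed.

HB.instance Definition _ :=
  GRing.Zmodule_isPzRing.Build functional fmulA fmul1 fmul1r fmulDl fmulDr.

(* Non-triviality, by evaluation at the flat background: g^{mu nu} goes to
   eta^{mu nu}, every other field and every derivative to 0. *)
Fixpoint background (t : term T) : R[i] :=
  match t with
  | Tconst z => z
  | Tfield (Fginv mu nu) => eta mu nu
  | Tfield _ => 0
  | Tadd s t => background s + background t
  | Tmul s t => background s * background t
  | Tder _ _ => 0
  end.

Lemma background_hom t i j :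
  homogeneous t i j -> (i, j) != (0, 0) -> background t = 0.
Proof.
elim=> {t i j} //=.
- by case.
- by move=> s t i j _ IHs _ IHt ij; rewrite IHs // IHt // addr0.
- move=> s t i j k l _ IHs _ IHt.
  have [[-> ->]|ij] := eqVneq (i, j) (0, 0).
    by rewrite !add0r => /IHt ->; rewrite mulr0.
  by move=> _; rewrite IHs // mul0r.
Qed.

Lemma background_eq s t : equal_terms s t -> background s = background t.
Proof.
elim=> {s t} //=.
- by move=> s t u _ -> _ ->.
- by move=> s s' t t' _ -> _ ->.
- by move=> s s' t t' _ -> _ ->.
- by move=> s t u; rewrite addrA.
- by move=> s t; rewrite addrC.
- by move=> t; rewrite add0r.
- by move=> t; rewrite mulN1r addNr.
- by move=> s t u; rewrite mulrA.
- by move=> t; rewrite mul1r.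
- by move=> s t u; rewrite mulrDl.
- by move=> s t u; rewrite mulrDr.
- move=> s t i j k l hs ht.
  have [[-> ->]|ij] := eqVneq (i, j) (0, 0).
    by rewrite addr0 mul0r /sgn absz0 expr0 mul1r mulrC.
  by rewrite (background_hom hs ij) mul0r !mulr0.
- by move=> mu s t; rewrite addr0.
- by move=> mu s t; rewrite mul0r mulr0 addr0.
- by move=> mu nu; rewrite /eta eq_sym; case: eqP => // ->.
- move=> mu nu.
  rewrite (big_morph background (id1 := 0) (op1 := +%R)) //=.
  under eq_bigr do rewrite mulr0 addr0.
  rewrite (bigD1 mu) //= big1 ?addr0; last first.
    by move=> rho; rewrite /eta eq_sym => /negbTE ->; rewrite mul0r.
  by rewrite /eta eqxx; case: (mu == nu); case: (mu == ord0);
    rewrite ?mulr1 ?mulr0 // mulrNN mulr1.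
Qed.

Lemma functional_nonzero : (1 : functional) != 0.
Proof.
by apply/eqP => /clsP/background_eq/eqP; rewrite oner_eq0.
Qed.

HB.instance Definition _ :=
  GRing.PzSemiRing_isNonZero.Build functional functional_nonzero.

Lemma fscaleA w z x : fscale w (fscale z x) = fscale (w * z) x.
Proof. by rewrite /fscale fconstM fmulA. Qed.

Lemma fscale1 : left_id 1 fscale.
Proof. exact: fmul1. Qed.

Lemma fscaleDr : right_distributive fscale +%R.
Proof. by move=> z x y; exact: fmulDr. Qed.

Lemma fscaleDl x : {morph fscale^~ x : w z / w + z}.
Proof. by move=> w z; rewrite /fscale fconstD; exact: fmulDl. Qed.

HB.instance Definition _ := GRing.Zmodule_isLmodule.Build R[i] functional
  fscaleA fscale1 fscaleDr fscaleDl.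

Lemma fscaleAl z (x y : functional) : z *: (x * y) = (z *: x) * y.
Proof. exact: fmulA. Qed.

HB.instance Definition _ :=
  GRing.Lmodule_isLalgebra.Build R[i] functional fscaleAl.

Lemma fscaleAr z (x y : functional) : z *: (x * y) = x * (z *: y).
Proof.
have zE u : z *: u = fconst z * u :> functional by [].
by rewrite !zE !mulrA; congr (_ * _); exact: fconst_central.
Qed.

HB.instance Definition _ :=
  GRing.Lalgebra_isAlgebra.Build R[i] functional fscaleAr.

Lemma fderD mu (x y : functional) : fder mu (x + y) = fder mu x + fder mu y.
Proof.
elim/cls_ind: x => s; elim/cls_ind: y => t.
have e : cls (Tder mu (Tadd s t)) = cls (Tadd (Tder mu s) (Tder mu t)).
  by apply/clsP/et_derD.
by move: e; rewrite cls_der !cls_add !cls_der.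
Qed.

Lemma fderM mu (x y : functional) :
  fder mu (x * y) = fder mu x * y + x * fder mu y.
Proof.
elim/cls_ind: x => s; elim/cls_ind: y => t.
have e : cls (Tder mu (Tmul s t))
    = cls (Tadd (Tmul (Tder mu s) t) (Tmul s (Tder mu t))).
  by apply/clsP/et_derM.
by move: e; rewrite cls_der cls_add !cls_mul !cls_der.
Qed.

Lemma fder_is_linear mu : linear (fder mu).
Proof.
move=> z x y; rewrite fderD; congr (_ + _).
have zE u : z *: u = fconst z * u :> functional by [].
have d0 : fder mu (fconst z) = 0.
  by rewrite -[LHS]cls_der; apply/clsP/et_der_const.
by rewrite !zE fderM d0 mul0r add0r.
Qed.

HB.instance Definition _ mu :=
  GRing.isLinear.Build R[i] functional functional _ (fder mu) (fder_is_linear mu).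

Lemma fderC mu nu (x : functional) : fder mu (fder nu x) = fder nu (fder mu x).
Proof.
by elim/cls_ind: x => t; rewrite -!cls_der; apply/clsP/et_derC.
Qed.

(** * Gradings and super vector fields *)

Definition in_bidegree (i j : int) (x : functional) : Prop :=
  exists2 t, homogeneous t i j & x = cls t.

(* Sums of elements of bidegrees (i, j) with i + j = d. *)
Inductive in_degree (d : int) : functional -> Prop :=
  | in_degree0 : in_degree d 0
  | in_degreeD i j x y : i + j = d -> in_bidegree i j x -> in_degree d y ->
      in_degree d (x + y).

(* X_(i,j): superderivations of bidegree (i, j). *)
Definition super_vector_field2 (i j : int) (X : functional -> functional) : Prop :=
  [/\ linear X,
      forall k l x, in_bidegree k l x -> in_bidegree (k + i) (l + j) (X x)
    & forall k l x y, in_bidegree k l x ->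
        X (x * y) = X x * y + sgn ((i + j) * (k + l)) *: (x * X y)].

(* X_(d): superderivations of total ghost degree d. *)
Definition super_vector_field (d : int) (X : functional -> functional) : Prop :=
  [/\ linear X,
      forall k x, in_degree k x -> in_degree (k + d) (X x)
    & forall k x y, in_degree k x ->
        X (x * y) = X x * y + sgn (d * k) *: (x * X y)].

(* [X, Y] for X and Y of total degrees d and e. *)
Definition supercommutator (d e : int) (X Y : functional -> functional) :
    functional -> functional :=
  fun x => X (Y x) - sgn (d * e) *: Y (X x).

Definition cohomological (X : functional -> functional) : Prop :=
  super_vector_field 1 X /\ forall x, supercommutator 1 1 X X x = 0.

Definition commutes_with_der (X : functional -> functional) : Prop :=
  forall mu x, X (fder mu x) = fder mu (X x).

(** * The BRST operators *)

Definition fld (x : field_component T) : functional := cls (Tfield x).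

Definition h_ mu nu := fld (Fh T mu nu).
Definition ginv mu nu := fld (Fginv T mu nu).
Definition viel mu m := fld (Fe T mu m).
Definition A_ a mu := fld (FA a mu).
Definition Phi_ k := fld (FPhi k).
Definition Psi_ k := fld (FPsi k).
Definition B_ rho := fld (FB T rho).
Definition b_ a := fld (Fb a).
Definition C_ rho := fld (FC T rho).
Definition Cbar_ rho := fld (FCbar T rho).
Definition c_ a := fld (Fc a).
Definition cbar_ a := fld (Fcbar a).

Definition metric mu nu : functional := (eta mu nu)%:A + (kappa T)%:C *: h_ mu nu.

(* C^rho = g^{rho sigma} C_sigma *)
Definition Cup rho : functional := \sum_sigma ginv rho sigma * C_ sigma.

(* e^{mu m} = g^{mu nu} e_nu^m *)
Definition vielup mu m : functional := \sum_nu ginv mu nu * viel nu m.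

(* Gamma^rho_{mu nu} *)
Definition christoffel rho mu nu : functional :=
  2^-1 *: \sum_sigma ginv rho sigma *
    (fder mu (metric sigma nu) + fder nu (metric mu sigma)
     - fder sigma (metric mu nu)).

(* Components omega_mu^{mn} of the spin connection. *)
Definition spin_connection mu m n : functional :=
  \sum_nu viel nu m *
    (fder mu (vielup nu n) + \sum_sigma christoffel nu mu sigma * vielup sigma n).

Definition matact n (M : 'M[R[i]]_n) (phi : 'I_n -> functional) (k : 'I_n) :
    functional :=
  \sum_l M k l *: phi l.

Definition sigma m n : 'M[R[i]]_(spinor_dim T) := spin_generator (gamma T) m n.

(* d_mu Psi + (1/8) omega_mu^{mn} [gamma_m, gamma_n] Psi: the spin connection
   acting on the twisted spinor Psi, without the gauge connection A, as in
   Kosmann's Lie derivative; a gauge covariant derivative here would break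
   [P, Q] = 0 by the term kappa g C^rho (d_rho c^a) S_a Psi. *)
Definition nablaPsi mu k : functional :=
  fder mu (Psi_ k)
  - ('i / 2) *: \sum_m \sum_n spin_connection mu m n * matact (sigma m n) Psi_ k.

(* C^rho d_rho *)
Definition along_C (x : functional) : functional := \sum_rho Cup rho * fder rho x.

(* Lie derivative along C of a one-form x_mu. *)
Definition lie_C (x : 'I_4 -> functional) (mu : 'I_4) : functional :=
  along_C (x mu) + \sum_rho fder mu (Cup rho) * x rho.

(* Kosmann's Lie derivative along C of Psi. *)
Definition kosmann_C k : functional :=
  \sum_rho Cup rho * nablaPsi rho k
  + ('i / 4) *: \sum_mu \sum_nu \sum_m \sum_n
      (fder mu (C_ nu) - fder nu (C_ mu)) * vielup mu m * vielup nu n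
      * matact (sigma m n) Psi_ k.

Record diffeomorphism_BRST (P : functional -> functional) : Prop := {
  P_svf : super_vector_field2 1 0 P;
  P_der : commutes_with_der P;
  P_h : forall mu nu, P (h_ mu nu)
    = (zeta T)^-1%:C *: fder mu (C_ nu) + (zeta T)^-1%:C *: fder nu (C_ mu)
      - 2 *: \sum_rho C_ rho * christoffel rho mu nu;
  P_C : forall rho, P (C_ rho) = (kappa T)%:C *: along_C (C_ rho);
  P_Cbar : forall rho, P (Cbar_ rho) = (zeta T)^-1%:C *: B_ rho;
  P_B : forall rho, P (B_ rho) = 0;
  P_viel : forall mu m,
    P (viel mu m) = (kappa T)%:C *: lie_C (fun nu => viel nu m) mu;
  P_A : forall a mu, P (A_ a mu) = (kappa T)%:C *: lie_C (A_ a) mu;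
  P_c : forall a, P (c_ a) = (kappa T)%:C *: along_C (c_ a);
  P_cbar : forall a, P (cbar_ a) = (kappa T)%:C *: along_C (cbar_ a);
  P_b : forall a, P (b_ a) = (kappa T)%:C *: along_C (b_ a);
  P_Phi : forall k, P (Phi_ k) = (kappa T)%:C *: along_C (Phi_ k);
  P_Psi : forall k, P (Psi_ k) = (kappa T)%:C *: kosmann_C k
}.

Record gauge_BRST (Q : functional -> functional) : Prop := {
  Q_svf : super_vector_field2 0 1 Q;
  Q_der : commutes_with_der Q;
  Q_h : forall mu nu, Q (h_ mu nu) = 0;
  Q_viel : forall mu m, Q (viel mu m) = 0;
  Q_C : forall rho, Q (C_ rho) = 0;
  Q_Cbar : forall rho, Q (Cbar_ rho) = 0;
  Q_B : forall rho, Q (B_ rho) = 0;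
  Q_A : forall a mu, Q (A_ a mu)
    = (xi T)^-1%:C *: fder mu (c_ a)
      + (gcoup T)%:C *: \sum_d \sum_e (str a d e)%:C *: (c_ d * A_ e mu);
  Q_c : forall a, Q (c_ a)
    = (gcoup T / 2)%:C *: \sum_d \sum_e (str a d e)%:C *: (c_ d * c_ e);
  Q_cbar : forall a, Q (cbar_ a) = (xi T)^-1%:C *: b_ a;
  Q_b : forall a, Q (b_ a) = 0;
  Q_Phi : forall k, Q (Phi_ k)
    = (gcoup T)%:C *: \sum_a c_ a * matact (higgs_rep a) Phi_ k;
  Q_Psi : forall k, Q (Psi_ k)
    = (gcoup T)%:C *: \sum_a c_ a * matact (spinor_rep a) Psi_ k
}.

End Algebra.

(** * Existence of the BRST operators *)

Section Existence.
Context {R : realType} (T : model R).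
Local Notation functional := (functional T).
Local Notation cls := (\pi_functional).


Lemma sgnE (d : int) : sgn d = (-1) ^ d :> R[i].
Proof. by case: d => n //; rewrite /sgn NegzE abszN /= -invr_expz invr_sign. Qed.

Lemma sgnD d e : sgn (d + e) = sgn d * sgn e :> R[i].
Proof. by rewrite !sgnE expfzDr // oppr_eq0 oner_eq0. Qed.

Lemma sgn0 : sgn 0 = 1 :> R[i].
Proof. by []. Qed.

Lemma sgn1 : sgn 1 = -1 :> R[i].
Proof. by []. Qed.

Lemma sgnK d : sgn d * sgn d = 1 :> R[i].
Proof. by rewrite /sgn -expr2 sqrr_sign. Qed.

Lemma clsD s t : cls (Tadd s t) = cls s + cls t :> functional.
Proof. exact: cls_add. Qed.

Lemma clsM s t : cls (Tmul s t) = cls s * cls t :> functional.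
Proof. exact: cls_mul. Qed.

Lemma cls_const z : cls (Tconst z) = z%:A :> functional.
Proof. by rewrite -[RHS]/(fconst T z * 1) mulr1. Qed.

Lemma cls_const0 : cls (Tconst 0) = 0 :> functional.
Proof. by []. Qed.

Lemma cls_sum I (r : seq I) (F : I -> term T) :
  cls (\big[@Tadd R T/Tconst 0]_(x <- r) F x) = \sum_(x <- r) cls (F x) :> functional.
Proof. by apply: (big_morph (fun t => cls t : functional)) => [s t|//]; exact: clsD. Qed.

Lemma cls_metric mu nu : cls (Tmetric T mu nu) = metric T mu nu.
Proof. by rewrite clsD clsM !cls_const mulr_algl. Qed.

Lemma h_sym mu nu : h_ T mu nu = h_ T nu mu.
Proof. by apply/clsP/et_h_sym. Qed.

Lemma ginv_sym mu nu : ginv T mu nu = ginv T nu mu.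
Proof. by apply/clsP/et_ginv_sym. Qed.

Lemma metric_sym mu nu : metric T mu nu = metric T nu mu.
Proof.
by rewrite /metric h_sym /eta eq_sym; case: eqP => // ->.
Qed.

Lemma ginvP mu nu :
  \sum_rho ginv T mu rho * metric T rho nu = (mu == nu)%:R.
Proof.
have : cls (Tconst (mu == nu)%:R) = (mu == nu)%:R :> functional.
  by rewrite cls_const; case: eqP; rewrite ?scale1r ?scale0r.
move <-; have /clsP <- := et_ginv T mu nu; rewrite cls_sum.
by apply: eq_bigr => rho _; rewrite clsM cls_metric.
Qed.

Lemma der1 mu : fder mu (1 : functional) = 0.
Proof.
have := fderM mu (1 : functional) 1; rewrite !mulr1 mul1r => e.
by apply: (addrI (fder mu (1 : functional))); rewrite addr0 -e.
Qed.

(* Closure properties of the bigrading. *)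

Lemma bideg0 i j : in_bidegree i j (0 : functional).
Proof. by exists (Tconst 0) => //; exact: hom_zero. Qed.

Lemma bideg1 : in_bidegree 0 0 (1 : functional).
Proof. by exists (Tconst 1) => //; exact: hom_const. Qed.

Lemma bidegD i j (x y : functional) :
  in_bidegree i j x -> in_bidegree i j y -> in_bidegree i j (x + y).
Proof.
by move=> [s hs ->] [t ht ->]; exists (Tadd s t); [exact: hom_add|rewrite clsD].
Qed.

Lemma bidegM i j k l m n (x y : functional) :
  in_bidegree i j x -> in_bidegree k l y -> m = i + k -> n = j + l ->
  in_bidegree m n (x * y).
Proof.
move=> [s hs ->] [t ht ->] -> ->.
by exists (Tmul s t); [exact: hom_mul|rewrite clsM].
Qed.

Lemma bidegMl i j (x y : functional) :
  in_bidegree 0 0 x -> in_bidegree i j y -> in_bidegree i j (x * y).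
Proof. by move=> hx hy; apply: (bidegM hx hy); rewrite add0r. Qed.

Lemma bidegMr i j (x y : functional) :
  in_bidegree i j x -> in_bidegree 0 0 y -> in_bidegree i j (x * y).
Proof. by move=> hx hy; apply: (bidegM hx hy); rewrite addr0. Qed.

Lemma bidegZ i j z (x : functional) : in_bidegree i j x -> in_bidegree i j (z *: x).
Proof.
move=> hx; rewrite -mulr_algl; apply: bidegMl => //.
by exists (Tconst z); [exact: hom_const|rewrite cls_const].
Qed.

Lemma bidegN i j (x : functional) : in_bidegree i j x -> in_bidegree i j (- x).
Proof. by rewrite -scaleN1r; exact: bidegZ. Qed.

Lemma bidegB i j (x y : functional) :
  in_bidegree i j x -> in_bidegree i j y -> in_bidegree i j (x - y).
Proof. by move=> hx hy; apply/bidegD/bidegN. Qed.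

Lemma bideg_der i j mu (x : functional) :
  in_bidegree i j x -> in_bidegree i j (fder mu x).
Proof.
by move=> [s hs ->]; exists (Tder mu s); [exact: hom_der|rewrite cls_der].
Qed.

Lemma bideg_sum i j I (r : seq I) (F : I -> functional) :
  (forall x, in_bidegree i j (F x)) -> in_bidegree i j (\sum_(x <- r) F x).
Proof.
move=> hF; elim/big_rec: _ => [|x y _ hy]; [exact: bideg0|exact: bidegD].
Qed.

Lemma bideg_fld (x : field_component T) i j :
  ghost_degree x = (i, j) -> in_bidegree i j (fld x).
Proof.
by move=> dx; exists (Tfield x) => //; have := hom_field x; rewrite dx.
Qed.

Lemma bideg_supercomm i j k l (x y : functional) :
  in_bidegree i j x -> in_bidegree k l y ->
  x * y = sgn ((i + j) * (k + l)) *: (y * x).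
Proof.
by move=> [s hs ->] [t ht ->]; exact: (homogeneous_supercomm hs ht).
Qed.

Lemma even_comm (x y : functional) i j :
  in_bidegree 0 0 x -> in_bidegree i j y -> x * y = y * x.
Proof.
by move=> hx hy; rewrite (bideg_supercomm hx hy) addr0 mul0r sgn0 scale1r.
Qed.

(* The parity automorphism and the odd superderivation with prescribed values
   on the generators. *)

Fixpoint parity_aut (t : term T) : functional :=
  match t with
  | Tconst z => z%:A
  | Tfield x => sgn ((ghost_degree x).1 + (ghost_degree x).2) *: fld x
  | Tadd s t => parity_aut s + parity_aut t
  | Tmul s t => parity_aut s * parity_aut t
  | Tder mu t => fder mu (parity_aut t)
  end.

Fixpoint odd_der (v : field_component T -> functional) (t : term T) : functional :=
  match t with
  | Tconst _ => 0
  | Tfield x => v x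
  | Tadd s t => odd_der v s + odd_der v t
  | Tmul s t => odd_der v s * cls t + parity_aut s * odd_der v t
  | Tder mu t => fder mu (odd_der v t)
  end.

Lemma parity_aut_hom t i j :
  homogeneous t i j -> parity_aut t = sgn (i + j) *: cls t.
Proof.
elim=> {t i j} /=.
- by move=> i j; rewrite scale0r cls_const0 scaler0.
- by move=> z; rewrite addr0 sgn0 scale1r cls_const.
- by [].
- by move=> s t i j _ -> _ ->; rewrite clsD scalerDr.
- move=> s t i j k l _ -> _ ->.
  by rewrite addrACA [sgn (i + j + _)]sgnD clsM -scalerAl -scalerAr scalerA.
- by move=> mu t i j _ ->; rewrite linearZ /= cls_der.
Qed.

Lemma parity_aut_eq s t : equal_terms s t -> parity_aut s = parity_aut t.
Proof.
elim=> {s t} //=.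
- by move=> s t u _ -> _ ->.
- by move=> s s' t t' _ -> _ ->.
- by move=> s s' t t' _ -> _ ->.
- by move=> mu s t _ ->.
- by move=> s t u; rewrite addrA.
- by move=> s t; rewrite addrC.
- by move=> t; rewrite scale0r add0r.
- by move=> t; rewrite scaleN1r mulN1r addNr scale0r.
- by move=> s t u; rewrite mulrA.
- by move=> t; rewrite scale1r mul1r.
- by move=> s t u; rewrite mulrDl.
- by move=> s t u; rewrite mulrDr.
- by move=> w z; rewrite scalerDl.
- by move=> w z; rewrite mulr_algl scalerA.
- move=> s t i j k l hs ht; rewrite (parity_aut_hom hs) (parity_aut_hom ht).
  rewrite mulr_algl -!scalerAl -!scalerAr.
  have /clsP := et_supercomm hs ht; rewrite !clsM cls_const mulr_algl => ->.
  by rewrite !scalerA mulrC [sgn (i + j) * _]mulrC mulrA.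
- by move=> mu s t; rewrite linearD.
- by move=> mu s t; rewrite fderM.
- by move=> mu z; rewrite linearZ /= der1 scaler0 scale0r.
- by move=> mu nu t; rewrite fderC.
- by move=> mu nu; rewrite -[fld _]/(h_ T mu nu) h_sym.
- by move=> mu nu; rewrite -[fld _]/(ginv T mu nu) ginv_sym.
- move=> mu nu.
  rewrite (big_morph parity_aut (id1 := 0) (op1 := +%R)) //= ?scale0r //.
  transitivity ((mu == nu)%:R : functional).
    rewrite -ginvP; apply: eq_bigr => rho _.
    by rewrite !addr0 !sgn0 !scale1r mulr_algl.
  by case: eqP; rewrite ?scale1r ?scale0r.
Qed.

Section OddDerivation.
Context (v : field_component T -> functional) (i j : int).
Hypothesis ij_odd : sgn (i + j) = -1 :> R[i].
Hypothesis v_bideg : forall x,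
  in_bidegree ((ghost_degree x).1 + i) ((ghost_degree x).2 + j) (v x).
Hypothesis v_h : forall mu nu, v (Fh T mu nu) = v (Fh T nu mu).
Hypothesis v_ginv : forall mu nu, v (Fginv T mu nu) = v (Fginv T nu mu).
Hypothesis v_inv : forall mu nu,
  \sum_rho (v (Fginv T mu rho) * metric T rho nu
            + ginv T mu rho * ((kappa T)%:C *: v (Fh T rho nu))) = 0.

Lemma odd_der_hom t k l :
  homogeneous t k l -> in_bidegree (k + i) (l + j) (odd_der v t).
Proof.
elim=> {t k l} /=.
- by move=> k l; exact: bideg0.
- by move=> z; exact: bideg0.
- by move=> x; exact: v_bideg.
- by move=> s t k l _ hs _ ht; exact: bidegD.
- move=> s t k l m n hs hs' ht ht'; apply: bidegD.
    apply: (bidegM hs' (k := m) (l := n)); first by exists t.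
      by rewrite addrAC.
    by rewrite addrAC.
  rewrite (parity_aut_hom hs) -scalerAl; apply: bidegZ.
  by apply: (bidegM (i := k) (j := l) _ ht'); rewrite ?addrA //; exists s.
- by move=> mu t k l _ ht; exact: bideg_der.
Qed.

Lemma odd_der_eq s t : equal_terms s t -> odd_der v s = odd_der v t.
Proof.
elim=> {s t} //=.
- by move=> s t u _ -> _ ->.
- by move=> s s' t t' _ -> _ ->.
- move=> s s' t t' es -> et ->.
  by rewrite (parity_aut_eq es); congr (_ * _ + _); exact/clsP.
- by move=> mu s t _ ->.
- by move=> s t u; rewrite addrA.
- by move=> s t; rewrite addrC.
- by move=> t; rewrite add0r.
- by move=> t; rewrite mul0r add0r scaleN1r mulN1r addNr.
- move=> s t u; rewrite !clsM mulrDl mulrDr !mulrA.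
  by rewrite addrA.
- by move=> t; rewrite mul0r add0r scale1r mul1r.
- by move=> s t u; rewrite !mulrDl addrACA.
- by move=> s t u; rewrite clsD !mulrDr addrACA.
- by move=> w z; rewrite addr0.
- by move=> w z; rewrite mul0r mulr0 addr0.
- move=> s t k l m n hs ht; rewrite mul0r add0r mulr_algl.
  have hs' := odd_der_hom hs; have ht' := odd_der_hom ht.
  have cs : in_bidegree k l (cls s : functional) by exists s.
  have ct : in_bidegree m n (cls t : functional) by exists t.
  rewrite (parity_aut_hom hs) (parity_aut_hom ht).
  rewrite -!scalerAl (bideg_supercomm hs' ct) (bideg_supercomm cs ht').
  rewrite scalerDr !scalerA addrC.
  have -> : k + i + (l + j) = (k + l) + (i + j) by rewrite addrACA.
  have -> : m + i + (n + j) = (m + n) + (i + j) by rewrite addrACA.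
  have e (d : int) : sgn ((i + j) * d) = sgn d :> R[i].
    rewrite /sgn abszM exprM -[(-1) ^+ _]/(sgn (i + j)) ij_odd.
    by [].
  congr (_ *: _ + _ *: _).
    by rewrite (mulrDr (k + l) (m + n)) (sgnD (_ * (m + n))) [_ * (i + j)]mulrC e mulrCA sgnK mulr1.
  by rewrite (mulrDl (k + l)) (sgnD (_ * (m + n))) e.
- by move=> mu s t; rewrite linearD.
- by move=> mu s t; rewrite linearD /= !fderM cls_der addrACA.
- by move=> mu z; rewrite linear0.
- by move=> mu nu t; rewrite fderC.
- move=> mu nu.
  rewrite (big_morph (odd_der v) (id1 := 0) (op1 := +%R)) //=.
  rewrite -[RHS](v_inv mu nu); apply: eq_bigr => rho _.
  rewrite cls_metric mul0r !add0r sgn0 scale1r.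
  by rewrite !mulr_algl.
Qed.

Definition odd_vf (x : functional) : functional := odd_der v (repr x).

Lemma odd_vfE t : odd_vf (cls t) = odd_der v t.
Proof. exact/odd_der_eq/repr_cls. Qed.

Lemma odd_vf_svf : super_vector_field2 i j odd_vf.
Proof.
split.
- move=> z; elim/(@cls_ind R T)=> s; elim/(@cls_ind R T)=> t.
  rewrite -mulr_algl -cls_const -clsM -clsD !odd_vfE /=.
  by rewrite mul0r add0r mulr_algl.
- by move=> k l x [t ht ->]; rewrite odd_vfE; exact: odd_der_hom.
- move=> k l x y [s hs ->]; elim/(@cls_ind R T): y => t.
  rewrite -clsM !odd_vfE /= (parity_aut_hom hs) -scalerAl.
  congr (_ + _ *: _).
  by rewrite /sgn abszM exprM -[(-1) ^+ `|i + j|]/(sgn (i + j)) ij_odd.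
Qed.

Lemma odd_vf_der : commutes_with_der odd_vf.
Proof. by move=> mu; elim/(@cls_ind R T)=> t; rewrite -cls_der !odd_vfE. Qed.

Lemma odd_vf_fld x : odd_vf (fld x) = v x.
Proof. by rewrite odd_vfE. Qed.

End OddDerivation.

Lemma bideg_h mu nu : in_bidegree 0 0 (h_ T mu nu).
Proof. exact: bideg_fld. Qed.

Lemma bideg_ginv mu nu : in_bidegree 0 0 (ginv T mu nu).
Proof. exact: bideg_fld. Qed.

Lemma bideg_viel mu m : in_bidegree 0 0 (viel T mu m).
Proof. exact: bideg_fld. Qed.

Lemma bideg_C rho : in_bidegree 1 0 (C_ T rho).
Proof. exact: bideg_fld. Qed.

Lemma bideg_Cup rho : in_bidegree 1 0 (Cup T rho).
Proof.
by apply: bideg_sum => s; apply: bidegMl; [exact: bideg_ginv|exact: bideg_C].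
Qed.

Lemma bideg_metric mu nu : in_bidegree 0 0 (metric T mu nu).
Proof. by apply: bidegD; apply: bidegZ; [exact: bideg1|exact: bideg_h]. Qed.

Lemma bideg_vielup mu m : in_bidegree 0 0 (vielup T mu m).
Proof.
by apply: bideg_sum => s; apply: bidegMl; [exact: bideg_ginv|exact: bideg_viel].
Qed.

Lemma bideg_christoffel rho mu nu : in_bidegree 0 0 (christoffel T rho mu nu).
Proof.
apply: bidegZ; apply: bideg_sum => s; apply: bidegMl; first exact: bideg_ginv.
by apply: bidegB; [apply: bidegD|]; apply: bideg_der; exact: bideg_metric.
Qed.

Lemma bideg_spin_connection mu m n : in_bidegree 0 0 (spin_connection T mu m n).
Proof.
apply: bideg_sum => nu; apply: bidegMl; first exact: bideg_viel.
apply: bidegD; first by apply: bideg_der; exact: bideg_vielup.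
apply: bideg_sum => s; apply: bidegMl; first exact: bideg_christoffel.
exact: bideg_vielup.
Qed.

Lemma bideg_matact n (M : 'M[R[i]]_n) (phi : 'I_n -> functional) i j k :
  (forall l, in_bidegree i j (phi l)) -> in_bidegree i j (matact M phi k).
Proof. by move=> hphi; apply: bideg_sum => l; exact: bidegZ. Qed.

Lemma bideg_along_C (x : functional) i j :
  in_bidegree i j x -> in_bidegree (i + 1) (j + 0) (along_C x).
Proof.
move=> hx; apply: bideg_sum => rho.
by apply: (bidegM (bideg_Cup rho) (bideg_der rho hx)); rewrite addrC.
Qed.

Lemma bideg_lie_C (x : 'I_4 -> functional) mu :
  (forall nu, in_bidegree 0 0 (x nu)) -> in_bidegree 1 0 (lie_C x mu).
Proof.
move=> hx; apply: bidegD; first exact: (bideg_along_C (hx mu)).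
by apply: bideg_sum => rho; apply: bidegMr => //; apply/bideg_der/bideg_Cup.
Qed.

Lemma bideg_kosmann_C k : in_bidegree 1 0 (kosmann_C (T := T) k).
Proof.
have hPsi l : in_bidegree 0 0 (Psi_ (T := T) l) by exact: bideg_fld.
apply: bidegD.
  apply: bideg_sum => rho; apply: bidegMr; first exact: bideg_Cup.
  apply: bidegB; first exact: bideg_der.
  apply: bidegZ; apply: bideg_sum => m; apply: bideg_sum => n.
  by apply: bidegMl; [exact: bideg_spin_connection|exact: bideg_matact].
apply: bidegZ; do 4 ![apply: bideg_sum => ?].
apply: bidegMr; last exact: bideg_matact.
do 2 ![apply: bidegMr; last exact: bideg_vielup].
by apply: bidegB; apply: bideg_der; exact: bideg_C.
Qed.

Definition P_h_val mu nu : functional :=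
  (zeta T)^-1%:C *: fder mu (C_ T nu) + (zeta T)^-1%:C *: fder nu (C_ T mu)
  - 2 *: \sum_rho C_ T rho * christoffel T rho mu nu.

Lemma christoffel_sym rho mu nu : christoffel T rho mu nu = christoffel T rho nu mu.
Proof.
congr (_ *: _); apply: eq_bigr => s _; congr (_ * _).
rewrite [in LHS](metric_sym mu nu) (metric_sym s nu) (metric_sym mu s).
by congr (_ - _); rewrite addrC.
Qed.

Lemma P_h_val_sym mu nu : P_h_val mu nu = P_h_val nu mu.
Proof.
rewrite /P_h_val; congr (_ - _ *: _); first by rewrite addrC.
by apply: eq_bigr => s _; rewrite christoffel_sym.
Qed.

Lemma bideg_P_h_val mu nu : in_bidegree 1 0 (P_h_val mu nu).
Proof.
apply: bidegB.
  by apply: bidegD; apply: bidegZ; apply: bideg_der; exact: bideg_C.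
apply: bidegZ; apply: bideg_sum => s; apply: bidegMr; first exact: bideg_C.
exact: bideg_christoffel.
Qed.

Definition P_val (x : field_component T) : functional :=
  match x with
  | Fh mu nu => P_h_val mu nu
  | Fginv mu nu => - \sum_al \sum_be
      ginv T mu al * ((kappa T)%:C *: P_h_val al be) * ginv T be nu
  | Fe mu m => (kappa T)%:C *: lie_C (fun nu => viel T nu m) mu
  | FA a mu => (kappa T)%:C *: lie_C (A_ a) mu
  | FPhi k => (kappa T)%:C *: along_C (Phi_ k)
  | FPsi k => (kappa T)%:C *: kosmann_C k
  | FB _ => 0
  | Fb a => (kappa T)%:C *: along_C (b_ a)
  | FC rho => (kappa T)%:C *: along_C (C_ T rho)
  | FCbar rho => (zeta T)^-1%:C *: B_ T rho
  | Fc a => (kappa T)%:C *: along_C (c_ a)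
  | Fcbar a => (kappa T)%:C *: along_C (cbar_ a)
  end.

Lemma diffeomorphism_BRST_exists :
  exists P : functional -> functional, diffeomorphism_BRST P.
Proof.
have hb : forall x, in_bidegree ((ghost_degree x).1 + 1) ((ghost_degree x).2 + 0)
    (P_val x).
  case=> [mu nu|mu nu|mu m|a mu|k|k|rho|a|rho|rho|a|a] /=;
    try (by apply: bidegZ; apply: bideg_along_C; exact: bideg_fld).
  - exact: bideg_P_h_val.
  - apply: bidegN; do 2 ![apply: bideg_sum => ?].
    apply: bidegMr; last exact: bideg_ginv.
    by apply: bidegMl; [exact: bideg_ginv|apply/bidegZ/bideg_P_h_val].
  - by apply: bidegZ; apply: bideg_lie_C => ?; exact: bideg_viel.
  - by apply: bidegZ; apply: bideg_lie_C => ?; exact: bideg_fld.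
  - by apply/bidegZ/bideg_kosmann_C.
  - exact: bideg0.
  - by apply: bidegZ; exact: bideg_fld.
have hh mu nu : P_val (Fh T mu nu) = P_val (Fh T nu mu) by exact: P_h_val_sym.
have hg mu nu : P_val (Fginv T mu nu) = P_val (Fginv T nu mu).
  rewrite /=; congr (- _); rewrite exchange_big /=.
  apply: eq_bigr => be _; apply: eq_bigr => al _.
  rewrite (P_h_val_sym al be) (ginv_sym mu al) (ginv_sym be nu).
  have hk : in_bidegree 1 0 ((kappa T)%:C *: P_h_val be al).
    by apply/bidegZ/bideg_P_h_val.
  rewrite -mulrA (even_comm (bideg_ginv al mu) (bidegMr hk (bideg_ginv nu be))).
  rewrite -(even_comm (bideg_ginv nu be) hk).
  by rewrite -mulrA.
have key (x : functional) be nu :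
    \sum_rho x * ginv T be rho * metric T rho nu = x * (be == nu)%:R.
  by rewrite -ginvP mulr_sumr; apply: eq_bigr => rho _; rewrite mulrA.
have hi mu nu : \sum_rho (P_val (Fginv T mu rho) * metric T rho nu
    + ginv T mu rho * ((kappa T)%:C *: P_val (Fh T rho nu))) = 0.
  rewrite big_split /=; apply/eqP; rewrite addr_eq0; apply/eqP.
  under eq_bigr do rewrite mulNr mulr_suml.
  rewrite sumrN; congr (- _); rewrite exchange_big /=; apply: eq_bigr => al _.
  under eq_bigr do rewrite mulr_suml.
  rewrite exchange_big /= (bigD1 nu) //= [X in _ + X]big1 ?addr0.
    by rewrite key eqxx mulr1.
  by move=> be /negbTE bn; rewrite key bn mulr0.
exists (odd_vf P_val).
have ij : sgn (1 + 0) = -1 :> R[i] by [].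
split=> *; rewrite ?(odd_vf_fld ij hb hh hg hi) //.
- exact: odd_vf_svf ij hb hh hg hi.
- exact: odd_vf_der ij hb hh hg hi.
Qed.

Definition Q_val (x : field_component T) : functional :=
  match x with
  | FA a mu => (xi T)^-1%:C *: fder mu (c_ a)
      + (gcoup T)%:C *: \sum_d \sum_e (str a d e)%:C *: (c_ d * A_ e mu)
  | FPhi k => (gcoup T)%:C *: \sum_a c_ a * matact (higgs_rep a) (Phi_ (T := T)) k
  | FPsi k => (gcoup T)%:C *: \sum_a c_ a * matact (spinor_rep a) (Psi_ (T := T)) k
  | Fc a => (gcoup T / 2)%:C *: \sum_d \sum_e (str a d e)%:C *: (c_ d * c_ e)
  | Fcbar a => (xi T)^-1%:C *: b_ a
  | _ => 0
  end.

Lemma gauge_BRST_exists : exists Q : functional -> functional, gauge_BRST Q.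
Proof.
have hc a : in_bidegree 0 1 (c_ (T := T) a) by exact: bideg_fld.
have hb : forall x, in_bidegree ((ghost_degree x).1 + 0) ((ghost_degree x).2 + 1)
    (Q_val x).
  case=> [mu nu|mu nu|mu m|a mu|k|k|rho|a|rho|rho|a|a] /=;
    try exact: bideg0.
  - apply: bidegD; apply: bidegZ; first exact: bideg_der.
    do 2 ![apply: bideg_sum => ?]; apply: bidegZ; apply: bidegMr => //.
    exact: bideg_fld.
  - apply: bidegZ; apply: bideg_sum => a; apply: bidegMr => //.
    by apply: bideg_matact => l; exact: bideg_fld.
  - apply: bidegZ; apply: bideg_sum => a; apply: bidegMr => //.
    by apply: bideg_matact => l; exact: bideg_fld.
  - apply: bidegZ; do 2 ![apply: bideg_sum => ?]; apply: bidegZ.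
    exact: bidegM.
  - by apply: bidegZ; exact: bideg_fld.
have hi mu nu : \sum_rho (Q_val (Fginv T mu rho) * metric T rho nu
    + ginv T mu rho * ((kappa T)%:C *: Q_val (Fh T rho nu))) = 0.
  by rewrite big1 // => rho _ /=; rewrite mul0r scaler0 mulr0 addr0.
have ij : sgn (0 + 1) = -1 :> R[i] by [].
exists (odd_vf Q_val).
split=> *; rewrite ?(odd_vf_fld ij hb _ _ hi) //.
- exact: odd_vf_svf ij hb _ _ hi.
- exact: odd_vf_der ij hb _ _ hi.
Qed.

End Existence.

(* Main.v *)
(* [P, Q] and [Q, Q] = 2 Q^2 are even superderivations commuting with the d_mu, so
   they vanish as soon as they vanish on the fields; the inverse metric is
   covered by its defining relation with h.
   Q kills everything built from h, e and C, hence it anticommutes with the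
   transport operator L = C^rho d_rho, and [P, Q] = [E, Q] for the odd
   derivation E = P - kappa L.  Now E kills c, cbar, b and Phi, sends A_mu to
   kappa (d_mu C^rho) A_rho and Psi to a Q-closed coefficient times sigma_mn
   Psi.  All the gauge transformations are, up to the inhomogeneous term of A,
   multiples of the operator phi |-> c^a S_a phi for a representation S of the
   Lie algebra (the adjoint one for c and A); E anticommutes with it because
   E c = 0, and its square is governed by the Jacobi identity. *)
Require Import Defs.
From mathcomp Require Import all_boot all_order all_algebra.
From mathcomp Require Import complex reals.
From mathcomp Require Import ssrAC generic_quotient.

Set Implicit Arguments.
Unset Strict Implicit.
Unset Printing Implicit Defensive.

Import GRing.Theory Num.Theory.
Local Open Scope ring_scope.
Local Open Scope complex_scope.
Local Open Scope quotient_scope.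

(** * Graded superderivations of the field algebra *)

Section SuperVectorFields.
Context {R : realType} {T : model R}.
Local Notation F := (functional T).
Implicit Types (x y : F) (X Y : F -> F).

Lemma in_degree_bidegree i j d x :
  in_bidegree i j x -> i + j = d -> in_degree d x.
Proof.
move=> hx ij; rewrite -[x]addr0; apply: in_degreeD ij hx _.
exact: in_degree0.
Qed.

Lemma in_degree_add d x y : in_degree d x -> in_degree d y -> in_degree d (x + y).
Proof.
move=> hx hy; elim: hx => [|i j u v ij hu _ IH]; first by rewrite add0r.
by rewrite -addrA; apply: in_degreeD ij hu IH.
Qed.

Lemma in_degreeZ d z x : in_degree d x -> in_degree d (z *: x).
Proof.
elim=> [|i j u v ij hu _ IH]; first by rewrite scaler0; exact: in_degree0.
by rewrite scalerDr; apply: in_degreeD ij (bidegZ z hu) IH.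
Qed.

(** Constants and fields are bihomogeneous, and products and derivatives preserve this, so every
    functional is a finite sum of bihomogeneous ones. Leibniz rules known only on homogeneous
    elements extend this way to the whole algebra. *)
Lemma bihomogeneous_ind (S : F -> Prop) :
  (forall i j x, in_bidegree i j x -> S x) ->
  (forall x y, S x -> S y -> S (x + y)) -> forall x, S x.
Proof.
move=> hS hD; elim/(@cls_ind R T) => t.
elim: t S hS hD => [z|f|s IHs t IHt|s IHs t IHt|mu t IHt] S hS hD.
- by apply: (hS 0 0); exists (Tconst z) => //; exact: hom_const.
- exact: hS (bideg_fld (surjective_pairing _)).
- by rewrite clsD; apply: (hD); [exact: (IHs S)|exact: (IHt S)].
(* The predicate varies in the induction: the left factor is decomposed with the right one fixed,
   then the right one. *)
- rewrite clsM; apply: (IHs (fun x => S (x * \pi_F t))) => [i j x hx|x y hx hy];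
    last by rewrite mulrDl; exact: hD.
  apply: (IHt (fun y => S (x * y))) => [k l y hy|u v hu hv];
    last by rewrite mulrDr; exact: hD.
  exact: hS (bidegM hx hy erefl erefl).
- rewrite cls_der; apply: (IHt (fun x => S (fder mu x))) => [i j x hx|x y hx hy].
    exact: hS (bideg_der mu hx).
  by rewrite linearD; exact: hD.
Qed.

Lemma super_vector_field2_total i j d X :
  super_vector_field2 i j X -> i + j = d -> super_vector_field d X.
Proof.
move=> [lX gX LX] ijd; split=> //.
- move=> k x; elim=> [|a b u v abk hu _ IH].
    have := lX (-1) 0 0; rewrite scaleN1r oppr0 addr0 scaleN1r addNr => ->.
    exact: in_degree0.
  rewrite -[u]scale1r lX scale1r; apply: in_degreeD IH; last exact: gX hu.
  by rewrite addrACA abk ijd.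
- move=> k x y; elim=> [|a b u v abk hu _ IH].
    have X0 : X 0 = 0.
      by have := lX (-1) 0 0; rewrite scaleN1r oppr0 addr0 scaleN1r addNr.
    by rewrite mul0r X0 !mul0r scaler0 addr0.
  have XD v' w : X (v' + w) = X v' + X w by rewrite -[v' in LHS]scale1r lX scale1r.
  rewrite mulrDl !XD IH (LX _ _ _ _ hu) ijd abk !mulrDl scalerDr.
  by rewrite addrACA.
Qed.

Lemma super_vector_field_add d X Y :
  super_vector_field d X -> super_vector_field d Y -> super_vector_field d (X \+ Y).
Proof.
move=> [lX gX LX] [lY gY LY]; split.
- by move=> z x y /=; rewrite lX lY scalerDr addrACA.
- by move=> k x hx /=; apply: in_degree_add; [exact: gX|exact: gY].
- move=> k x y hx /=; rewrite (LX _ _ _ hx) (LY _ _ _ hx) mulrDl mulrDr scalerDr.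
  by rewrite addrACA.
Qed.

Lemma super_vector_field_scale d z X :
  super_vector_field d X -> super_vector_field d (fun x => z *: X x).
Proof.
move=> [lX gX LX]; split.
- by move=> w x y; rewrite lX scalerDr !scalerA [z * w]mulrC.
- by move=> k x hx; apply/in_degreeZ/gX.
- move=> k x y hx; rewrite (LX _ _ _ hx) scalerDr -scalerAl -scalerAr.
  by rewrite !scalerA [z * _]mulrC.
Qed.

(** The left inverse is also a right inverse because both matrices are symmetric with even, hence
    commuting, entries. *)
Lemma metric_ginv mu nu :
  \sum_rho metric T mu rho * ginv T rho nu = (mu == nu)%:R.
Proof.
rewrite eq_sym -ginvP; apply: eq_bigr => rho _.
by rewrite metric_sym ginv_sym (even_comm (bideg_metric T _ _) (bideg_ginv T _ _)).
Qed.

Section OneField.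
Context (d : int) (X : F -> F) (hX : super_vector_field d X).

Lemma svfD x y : X (x + y) = X x + X y.
Proof. by have [lX _ _] := hX; rewrite -[x in LHS]scale1r lX scale1r. Qed.

Lemma svf0 : X 0 = 0.
Proof. by apply: (addrI (X 0)); rewrite -svfD !addr0. Qed.

Lemma svfZ z x : X (z *: x) = z *: X x.
Proof. by have [lX _ _] := hX; rewrite -[_ *: x]addr0 lX svf0 addr0. Qed.

Lemma svfN x : X (- x) = - X x.
Proof. by rewrite -scaleN1r svfZ scaleN1r. Qed.

Lemma svf_sum (I : Type) (r : seq I) (G : I -> F) :
  X (\sum_(i <- r) G i) = \sum_(i <- r) X (G i).
Proof. by apply: (big_morph X); [exact: svfD|exact: svf0]. Qed.

Lemma svf_matact n (M : 'M[R[i]]_n) (phi : 'I_n -> F) k :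
  X (matact M phi k) = matact M (X \o phi) k.
Proof. by rewrite svf_sum; apply: eq_bigr => l _; rewrite svfZ. Qed.

Lemma svfM0 x y : in_bidegree 0 0 x -> X (x * y) = X x * y + x * X y.
Proof.
move=> /in_degree_bidegree hx; have [_ _ LX] := hX.
by rewrite (LX _ _ _ (hx _ erefl)) addr0 mulr0 sgn0 scale1r.
Qed.

Lemma svf1 : X 1 = 0.
Proof.
have := svfM0 1 (bideg1 T); rewrite !mulr1 mul1r => e.
by apply: (addrI (X 1)); rewrite addr0 -e.
Qed.

Lemma svf_metric mu nu : X (metric T mu nu) = (kappa T)%:C *: X (h_ T mu nu).
Proof. by rewrite svfD !svfZ svf1 scaler0 add0r. Qed.

(** Differentiating [ginv * metric = 1] leaves [X ginv * metric = 0]; multiplying by [ginv] on the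
    right removes the metric. *)
Lemma svf_ginv0 :
  (forall mu nu, X (h_ T mu nu) = 0) -> forall mu nu, X (ginv T mu nu) = 0.
Proof.
move=> Xh mu nu.
have e s : \sum_rho X (ginv T mu rho) * metric T rho s = 0.
  transitivity (X (\sum_rho ginv T mu rho * metric T rho s)).
    rewrite svf_sum; apply: eq_bigr => rho _; rewrite svfM0; last exact: bideg_ginv.
    by rewrite svf_metric Xh scaler0 mulr0 addr0.
  by rewrite ginvP; case: eqP => _; [exact: svf1|exact: svf0].
have : \sum_s (\sum_rho X (ginv T mu rho) * metric T rho s) * ginv T s nu = 0.
  by apply: big1 => s _; rewrite e mul0r.
under eq_bigr do rewrite mulr_suml; rewrite exchange_big /=.
under eq_bigr => rho _.
  under eq_bigr do rewrite -mulrA.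
  rewrite -mulr_sumr metric_ginv.
  over.
rewrite (bigD1 nu) //= eqxx mulr1 [X in _ + X]big1 ?addr0 //.
by move=> rho /negbTE ->; rewrite mulr0.
Qed.

End OneField.

Section OddField.
Context (X : F -> F) (hX : super_vector_field 1 X).

Lemma svf1M_odd i j x y :
  in_bidegree i j x -> i + j = 1 -> X (x * y) = X x * y - x * X y.
Proof.
move=> hx ij; have [_ _ LX] := hX.
by rewrite (LX _ _ _ (in_degree_bidegree hx ij)) mulr1 sgn1 scaleN1r.
Qed.

Lemma svf1M_ker i j x y :
  in_bidegree i j x -> X x = 0 -> X y = 0 -> X (x * y) = 0.
Proof.
move=> hx Xx Xy; have [_ _ LX] := hX.
rewrite (LX _ _ _ (in_degree_bidegree hx erefl)) Xx Xy.
by rewrite mul0r mulr0 scaler0 addr0.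
Qed.

End OddField.

(** The mixed terms of the two compositions carry opposite signs, because an odd field shifts the
    degree of the left factor by one. *)
Lemma anticommutator_svf X Y :
  super_vector_field 1 X -> super_vector_field 1 Y ->
  super_vector_field 2 (fun x => X (Y x) + Y (X x)).
Proof.
move=> hX hY; have [lX gX LX] := hX; have [lY gY LY] := hY; split.
- by move=> z x y; rewrite lX lY lX lY scalerDr addrACA.
- move=> k x hx; have -> : k + 2 = k + 1 + 1 by rewrite -addrA.
  by apply: in_degree_add; [apply/gX/gY|apply/gY/gX].
- move=> k x y hx; rewrite (LX _ _ _ hx) (LY _ _ _ hx) !mul1r.
  rewrite (svfD hX) (svfD hY) (svfZ hX) (svfZ hY).
  rewrite (LX _ _ _ hx) (LY _ _ _ hx).
  rewrite (LX _ _ _ (gY _ _ hx)) (LY _ _ _ (gX _ _ hx)) !mul1r.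
  have -> : sgn (2 * k) = 1 :> R[i].
    by rewrite mulrDl mul1r sgnD sgnK.
  rewrite !sgnD sgn1 mulrN1 !scaleNr !scalerDr !scalerA sgnK !scale1r.
  rewrite mulrDl mulrDr.
  set a := X (Y x) * y; set b := Y (X x) * y.
  set p := sgn k *: (Y x * X y); set q := sgn k *: (X x * Y y).
  set u := x * X (Y y); set v := x * Y (X y).
  (* Each of [p] and [q] is paired with its own negative. *)
  rewrite (AC ((2*2)*(2*2)) ((1*5)*(4*8)*((2*7)*(3*6)))) /=.
  by rewrite addNr subrr !addr0.
Qed.

(** A superderivation of degree 2 obeys the unsigned Leibniz rule, so its vanishing spreads from the
    generators; [Fginv] may be left out since its image is determined by that of [h]. *)
Lemma svf2_eq0 X :
  super_vector_field 2 X -> commutes_with_der X ->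
  (forall f, (forall mu nu, f <> Fginv T mu nu) -> X (fld f) = 0) ->
  forall x, X x = 0.
Proof.
move=> hX dX fX.
have LX x y : X (x * y) = X x * y + x * X y.
  elim/bihomogeneous_ind: x => [i j x hx|x x' IH IH'].
    have [_ _ lX] := hX; rewrite (lX _ _ _ (in_degree_bidegree hx erefl)).
    by rewrite mulrDl mul1r sgnD sgnK scale1r.
  by rewrite mulrDl !(svfD hX) IH IH' !mulrDl addrACA.
have Xh mu nu : X (h_ T mu nu) = 0 by exact: fX.
elim/(@cls_ind R T); elim=> [z|f|s IHs t IHt|s IHs t IHt|mu t IHt].
- by rewrite cls_const (svfZ hX) (svf1 hX) scaler0.
- rewrite -[\pi_F _]/(fld f).
  case: f; try by move=> *; apply: fX.
  exact: svf_ginv0 hX Xh.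
- by rewrite clsD (svfD hX) IHs IHt addr0.
- by rewrite clsM LX IHs IHt mul0r mulr0 addr0.
- by rewrite cls_der dX IHt linear0.
Qed.

End SuperVectorFields.

(** * Matrices acting on multiplets of functionals *)

Section MatrixActions.
Context {R : realType} {T : model R}.
Local Notation F := (functional T).

Lemma matact_mulmx n (M N : 'M[R[i]]_n) (phi : 'I_n -> F) k :
  matact M (matact N phi) k = matact (M *m N) phi k.
Proof.
rewrite /matact; under eq_bigr do rewrite scaler_sumr.
rewrite exchange_big /=; apply: eq_bigr => l _.
by rewrite mxE scaler_suml; apply: eq_bigr => j _; rewrite scalerA.
Qed.

Lemma eq_matact n (M : 'M[R[i]]_n) (phi psi : 'I_n -> F) k :
  phi =1 psi -> matact M phi k = matact M psi k.
Proof. by move=> e; apply: eq_bigr => l _; rewrite e. Qed.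

Lemma matactB n (M N : 'M[R[i]]_n) (phi : 'I_n -> F) k :
  matact (M - N) phi k = matact M phi k - matact N phi k.
Proof. by rewrite -sumrB; apply: eq_bigr => l _; rewrite !mxE scalerBl. Qed.

Lemma matactDr n (M : 'M[R[i]]_n) (phi psi : 'I_n -> F) k :
  matact M (fun l => phi l + psi l) k = matact M phi k + matact M psi k.
Proof. by rewrite -big_split; apply: eq_bigr => l _; rewrite scalerDr. Qed.

Lemma matactZr n (M : 'M[R[i]]_n) z (phi : 'I_n -> F) k :
  matact M (fun l => z *: phi l) k = z *: matact M phi k.
Proof. by rewrite scaler_sumr; apply: eq_bigr => l _; rewrite !scalerA mulrC. Qed.

Lemma matactMr n (M : 'M[R[i]]_n) (x : F) (phi : 'I_n -> F) k :
  matact M (fun l => x * phi l) k = x * matact M phi k.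
Proof. by rewrite mulr_sumr; apply: eq_bigr => l _; rewrite scalerAr. Qed.

Lemma matact_sumr (J : finType) n (M : 'M[R[i]]_n) (phi : J -> 'I_n -> F) k :
  matact M (fun l => \sum_j phi j l) k = \sum_j matact M (phi j) k.
Proof.
by rewrite exchange_big; apply: eq_bigr => l _; rewrite scaler_sumr.
Qed.

Lemma matact_suml (J : finType) n (z : J -> R[i]) (M : J -> 'M[R[i]]_n)
    (phi : 'I_n -> F) k :
  matact (\sum_j z j *: M j) phi k = \sum_j z j *: matact (M j) phi k.
Proof.
under [RHS]eq_bigr do rewrite scaler_sumr.
rewrite exchange_big; apply: eq_bigr => l _.
by rewrite summxE scaler_suml; apply: eq_bigr => j _; rewrite mxE scalerA.
Qed.

End MatrixActions.

(** * The gauge Lie algebra acting through the ghosts *)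

Section GhostAction.
Context {R : realType} {T : model R}.
Local Notation F := (functional T).
Local Notation gauge := 'I_(gdim T).+1.
Local Notation c a := (c_ (T := T) a).
Local Notation f a b d := ((@str R T a b d)%:C : R[i]).

Lemma bideg_c a : in_bidegree 0 1 (c a).
Proof. exact: bideg_fld. Qed.

Lemma odd_anticomm i j k l (x y : F) :
  in_bidegree i j x -> in_bidegree k l y -> i + j = 1 -> k + l = 1 ->
  x * y = - (y * x).
Proof.
by move=> hx hy ij kl; rewrite (bideg_supercomm hx hy) ij kl mulr1 sgn1 scaleN1r.
Qed.

Lemma str_antiC a b d : f a b d = - f a d b.
Proof. by rewrite str_anti rmorphN. Qed.

Lemma str_jacobiC e a b d :
  \sum_s (f e a s * f s b d + f e b s * f s d a + f e d s * f s a b) = 0.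
Proof.
have /(congr1 (real_complex R)) := @str_jacobi R T e a b d.
rewrite rmorph0 rmorph_sum /= => K; rewrite -[RHS]K.
by apply: eq_bigr => s _; rewrite !rmorphD !rmorphM.
Qed.

(** The coupling is left out, so that one operator serves [Phi], [Psi], [A] and [c], whose
    transformations differ in their prefactors. *)
Definition ghost_action n (S : gauge -> 'M[R[i]]_n) (phi : 'I_n -> F) k : F :=
  \sum_a c a * matact (S a) phi k.

Lemma ghost_actionD n (S : gauge -> 'M[R[i]]_n) (phi psi : 'I_n -> F) k :
  ghost_action S (fun l => phi l + psi l) k
  = ghost_action S phi k + ghost_action S psi k.
Proof. by rewrite -big_split; apply: eq_bigr => a _; rewrite matactDr mulrDr. Qed.

Lemma ghost_actionZ n (S : gauge -> 'M[R[i]]_n) z (phi : 'I_n -> F) k :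
  ghost_action S (fun l => z *: phi l) k = z *: ghost_action S phi k.
Proof. by rewrite scaler_sumr; apply: eq_bigr => a _; rewrite matactZr scalerAr. Qed.

Lemma ghost_action_sum (J : finType) n (S : gauge -> 'M[R[i]]_n)
    (phi : J -> 'I_n -> F) k :
  ghost_action S (fun l => \sum_j phi j l) k = \sum_j ghost_action S (phi j) k.
Proof.
rewrite exchange_big; apply: eq_bigr => a _.
by rewrite matact_sumr mulr_sumr.
Qed.

Lemma eq_ghost_action n (S : gauge -> 'M[R[i]]_n) (phi psi : 'I_n -> F) k :
  phi =1 psi -> ghost_action S phi k = ghost_action S psi k.
Proof. by move=> e; apply: eq_bigr => a _; rewrite (eq_matact _ _ e). Qed.

Lemma ghost_action0 n (S : gauge -> 'M[R[i]]_n) k :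
  ghost_action S (fun=> 0 : F) k = 0.
Proof.
apply: big1 => a _; rewrite [matact _ _ _]big1 ?mulr0 // => l _.
by rewrite scaler0.
Qed.

Lemma svf_ghost_action (X : F -> F) n (S : gauge -> 'M[R[i]]_n) phi k :
  super_vector_field 1 X ->
  X (ghost_action S phi k)
  = \sum_a X (c_ a) * matact (S a) phi k - ghost_action S (X \o phi) k.
Proof.
move=> hX; rewrite (svf_sum hX) -sumrB; apply: eq_bigr => a _.
by rewrite (svf1M_odd hX _ (bideg_c a)) // (svf_matact hX).
Qed.

Lemma ghost_action_oddM n (S : gauge -> 'M[R[i]]_n) (w : F) (phi : 'I_n -> F) k i j :
  in_bidegree i j w -> i + j = 1 ->
  ghost_action S (fun l => w * phi l) k = - (w * ghost_action S phi k).
Proof.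
move=> hw ij; rewrite mulr_sumr -sumrN; apply: eq_bigr => a _.
by rewrite matactMr !mulrA (odd_anticomm (bideg_c a) hw) // mulNr.
Qed.

Lemma ghost_action_matact n (S : gauge -> 'M[R[i]]_n) M (phi : 'I_n -> F) k :
  (forall a, mxcomm (S a) M = 0) ->
  ghost_action S (matact M phi) k = matact M (ghost_action S phi) k.
Proof.
move=> hM; rewrite matact_sumr; apply: eq_bigr => a _.
rewrite matact_mulmx matactMr matact_mulmx; congr (_ * matact _ _ _).
by apply/eqP; rewrite -subr_eq0; apply/eqP/hM.
Qed.

(* The terms antisymmetric in the two ghosts survive, hence the commutator. *)
Lemma ghost_action_twice n (S : gauge -> 'M[R[i]]_n) (phi : 'I_n -> F) k :
  (forall a b, mxcomm (S a) (S b) = \sum_d f d a b *: S d) ->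
  2 *: ghost_action S (ghost_action S phi) k
  = \sum_a (\sum_d \sum_e f a d e *: (c d * c e)) * matact (S a) phi k.
Proof.
move=> hS.
have e : ghost_action S (ghost_action S phi) k
    = \sum_a \sum_b c a * c b * matact (S a *m S b) phi k.
  apply: eq_bigr => a _; rewrite matact_sumr mulr_sumr; apply: eq_bigr => b _.
  by rewrite matactMr matact_mulmx mulrA.
have e' : ghost_action S (ghost_action S phi) k
    = - \sum_a \sum_b c a * c b * matact (S b *m S a) phi k.
  rewrite e exchange_big -sumrN; apply: eq_bigr => b _ /=.
  rewrite -sumrN; apply: eq_bigr => a _.
  by rewrite (odd_anticomm (bideg_c a) (bideg_c b)) // mulNr.
rewrite scaler_nat mulr2n {1}e e' -sumrB.
under eq_bigr do rewrite -sumrB.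
under eq_bigr do under eq_bigr do
  rewrite -mulrBr -matactB -/(mxcomm _ _) hS matact_suml mulr_sumr.
under eq_bigr do rewrite exchange_big /=.
rewrite exchange_big /=; apply: eq_bigr => d _.
rewrite mulr_suml; apply: eq_bigr => a _.
rewrite mulr_suml; apply: eq_bigr => b _.
by rewrite -scalerAr scalerAl.
Qed.

(** With this placement of indices, the quadratic terms of [Q A] and [Q c] are ghost actions. *)
Definition adjoint (a : gauge) : 'M[R[i]]_((gdim T).+1) := \matrix_(b, e) f b a e.

(** Two uses of antisymmetry turn the difference of the sides into the Jacobi sum. *)
Lemma adjointP a b : mxcomm (adjoint a) (adjoint b) = \sum_d f d a b *: adjoint d.
Proof.
apply/matrixP => p q; rewrite !mxE summxE -sumrB.
under [RHS]eq_bigr do rewrite !mxE.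
under [LHS]eq_bigr do rewrite !mxE.
apply/eqP; rewrite -subr_eq0 -sumrB; apply/eqP.
rewrite -[RHS](str_jacobiC p a b q); apply: eq_bigr => d _.
by rewrite (str_antiC d q a) (str_antiC p q d) mulrN mulNr [f d a b * _]mulrC.
Qed.

Lemma ghost_action_adjoint (phi : gauge -> F) a :
  ghost_action adjoint phi a = \sum_d \sum_e f a d e *: (c d * phi e).
Proof.
apply: eq_bigr => d _; rewrite mulr_sumr; apply: eq_bigr => e _.
by rewrite mxE scalerAr.
Qed.

(** The two Leibniz terms agree: the sign from exchanging two odd factors cancels the one from
    antisymmetry of the structure constants. The resulting 2 compensates the 1/2 in [Q c]. *)
Lemma fder_ghost_action_c mu a :
  fder mu (ghost_action adjoint (c_ (T := T)) a)
  = 2 *: ghost_action adjoint (fun e => fder mu (c e)) a.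
Proof.
rewrite !ghost_action_adjoint scaler_nat mulr2n linear_sum.
under eq_bigr do rewrite linear_sum.
under eq_bigr do under eq_bigr do rewrite linearZ /= fderM scalerDr.
under eq_bigr do rewrite big_split.
rewrite big_split /=; congr (_ + _).
rewrite exchange_big; apply: eq_bigr => d _; apply: eq_bigr => e _ /=.
rewrite (odd_anticomm (bideg_der mu (bideg_c e)) (bideg_c d)) //.
by rewrite str_antiC scaleNr scalerN opprK.
Qed.

(* The cubic ghost monomials are cyclically invariant, so three times the sum
   is the Jacobi identity. *)
Lemma ghost_action_twice_c a :
  ghost_action adjoint (ghost_action adjoint (c_ (T := T))) a = 0.
Proof.
pose K p q e := \sum_d f a p d * f d q e.
have KE : ghost_action adjoint (ghost_action adjoint (c_ (T := T))) a
    = \sum_p \sum_q \sum_e K p q e *: (c p * c q * c e).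
  rewrite ghost_action_adjoint; apply: eq_bigr => p _.
  under eq_bigr do rewrite ghost_action_adjoint mulr_sumr scaler_sumr.
  rewrite exchange_big; apply: eq_bigr => q _ /=.
  under eq_bigr do rewrite mulr_sumr scaler_sumr.
  rewrite exchange_big; apply: eq_bigr => e _ /=.
  rewrite scaler_suml; apply: eq_bigr => d _.
  by rewrite -scalerAr scalerA mulrA.
(* A product of two ghosts is even, so the third ghost passes it without a sign. *)
have cyc p q e : c p * c q * c e = c q * c e * c p.
  rewrite -mulrA (bideg_supercomm (bideg_c p)
    (bidegM (bideg_c q) (bideg_c e) erefl erefl)).
  by rewrite -[(0 + 1) * _]/(1 + 1 : int) sgnD sgnK scale1r.
set S := LHS in KE *.
have KE' : S = \sum_p \sum_q \sum_e K q e p *: (c p * c q * c e).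
  rewrite KE [RHS]exchange_big; apply: eq_bigr => q _ /=.
  by rewrite [RHS]exchange_big; do 2 apply: eq_bigr => ? _; rewrite -cyc.
have KE'' : S = \sum_p \sum_q \sum_e K e p q *: (c p * c q * c e).
  rewrite KE; under [RHS]eq_bigr do rewrite exchange_big /=.
  rewrite [RHS]exchange_big; apply: eq_bigr => e _ /=.
  by do 2 apply: eq_bigr => ? _; rewrite cyc.
have : 3 *: S = 0.
  have -> : 3 *: S = S + S + S by rewrite scaler_nat !mulrS addr0 addrA.
  rewrite {1}KE {1}KE' KE'' -!big_split big1 // => p _.
  rewrite -!big_split big1 // => q _; rewrite -!big_split big1 // => e _ /=.
  rewrite -!scalerDl -!big_split /=.
  by rewrite str_jacobiC scale0r.
by move/eqP; rewrite scaler_eq0 pnatr_eq0 => /eqP.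
Qed.

End GhostAction.

(** * Transport along the graviton-ghost and Kosmann's derivative *)

Section GhostTransport.
Context {R : realType} {T : model R}.
Local Notation F := (functional T).

(** Even derivations [fder rho] with odd coefficients [Cup rho] combine into an odd
    superderivation. *)
Lemma along_C_svf : super_vector_field 1 (@along_C R T).
Proof.
apply: (@super_vector_field2_total _ _ 1 0) => //; split.
- move=> z x y; rewrite scaler_sumr -big_split; apply: eq_bigr => rho _.
  by rewrite linearP mulrDr scalerAr.
- by move=> k l x; exact: bideg_along_C.
- move=> k l x y hx; rewrite mulr_suml mulr_sumr scaler_sumr -big_split.
  apply: eq_bigr => rho _ /=.
  rewrite (fderM rho x y) mulrDr !mulrA; congr (_ + _).
  by rewrite (bideg_supercomm (bideg_Cup T rho) hx) -scalerAl.
Qed.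

(** The coefficients [C^rho] are themselves differentiated; the correction has the shape of the
    one-form term of [lie_C]. *)
Lemma along_C_fder mu (x : F) :
  along_C (fder mu x)
  = fder mu (along_C x) - \sum_rho fder mu (Cup T rho) * fder rho x.
Proof.
rewrite /along_C linear_sum -sumrB; apply: eq_bigr => rho _ /=.
by rewrite fderM (fderC mu rho x) [RHS]addrAC subrr add0r.
Qed.

(* Kosmann's derivative of Psi is the transport term C^rho d_rho Psi plus
   lorentz_C (m, n) sigma_mn Psi. *)
Definition lorentz_C (p : 'I_4 * 'I_4) : F :=
  - ('i / 2) *: (\sum_rho Cup T rho * spin_connection T rho p.1 p.2)
  + ('i / 4) *: \sum_mu \sum_nu
      (fder mu (C_ T nu) - fder nu (C_ T mu)) * vielup T mu p.1 * vielup T nu p.2.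

Lemma bideg_lorentz_C p : in_bidegree 1 0 (lorentz_C p).
Proof.
apply: bidegD; apply: bidegZ.
  apply: bideg_sum => rho; apply: bidegMr; first exact: bideg_Cup.
  exact: bideg_spin_connection.
do 2 ![apply: bideg_sum => ?].
do 2 ![apply: bidegMr; last exact: bideg_vielup].
by apply: bidegB; apply: bideg_der; exact: bideg_C.
Qed.

(** The sums over [m] and [n] are gathered into one sum over pairs, the form in which scalars and
    spinors can be treated alike. *)
Lemma kosmann_CE k : kosmann_C (T := T) k
  = along_C (Psi_ k) + \sum_p lorentz_C p * matact (sigma T p.1 p.2) (Psi_ (T := T)) k.
Proof.
rewrite /kosmann_C; under eq_bigr do rewrite mulrBr.
rewrite sumrB -addrA; congr (_ + _).
under [RHS]eq_bigr do rewrite mulrDl.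
rewrite big_split /=; congr (_ + _).
  rewrite -sumrN.
  under [RHS]eq_bigr do rewrite -scalerAl scaleNr mulr_suml scaler_sumr -sumrN.
  rewrite [RHS]exchange_big; apply: eq_bigr => rho _ /=.
  rewrite -scalerAr mulr_sumr scaler_sumr -sumrN.
  rewrite -[RHS](pair_bigA _ (fun m n => - ('i / 2 *:
    (Cup T rho * spin_connection T rho m n * matact (sigma T m n) (Psi_ (T := T)) k)))) /=.
  apply: eq_bigr => m _; rewrite mulr_sumr scaler_sumr -sumrN.
  by apply: eq_bigr => n _; rewrite mulrA.
under [RHS]eq_bigr do rewrite -scalerAl mulr_suml.
rewrite -scaler_sumr; congr (_ *: _).
rewrite [RHS]exchange_big; apply: eq_bigr => mu _ /=.
under [RHS]eq_bigr do rewrite mulr_suml.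
rewrite [RHS]exchange_big; apply: eq_bigr => nu _ /=.
by rewrite pair_bigA.
Qed.

End GhostTransport.

(** * Nilpotency of the gauge BRST operator *)

Section GaugeBRST.
Context {R : realType} {T : model R} (Q : functional T -> functional T).
Hypothesis Q_gauge : gauge_BRST Q.
Local Notation F := (functional T).
Local Notation gauge := 'I_(gdim T).+1.
Local Notation g := ((gcoup T)%:C : R[i]).

Lemma gauge_svf : super_vector_field 1 Q.
Proof. exact: super_vector_field2_total (Q_svf Q_gauge) _. Qed.

Let hQ := gauge_svf.

(** This value is not prescribed for [Q]; it follows from [Q h = 0] through the inverse relation. *)
Lemma gauge_ginv mu nu : Q (ginv T mu nu) = 0.
Proof. by apply: (svf_ginv0 hQ); exact: Q_h Q_gauge. Qed.

Lemma gauge_fder0 mu (x : F) : Q x = 0 -> Q (fder mu x) = 0.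
Proof. by move=> Qx; rewrite (Q_der Q_gauge) Qx linear0. Qed.

Lemma gauge_sum0 (I : Type) (r : seq I) (G : I -> F) :
  (forall j, Q (G j) = 0) -> Q (\sum_(j <- r) G j) = 0.
Proof. by move=> G0; rewrite (svf_sum hQ) big1. Qed.

Lemma gaugeZ0 z (x : F) : Q x = 0 -> Q (z *: x) = 0.
Proof. by move=> Qx; rewrite (svfZ hQ) Qx scaler0. Qed.

Lemma gaugeD0 (x y : F) : Q x = 0 -> Q y = 0 -> Q (x + y) = 0.
Proof. by move=> Qx Qy; rewrite (svfD hQ) Qx Qy addr0. Qed.

Lemma gaugeB0 (x y : F) : Q x = 0 -> Q y = 0 -> Q (x - y) = 0.
Proof. by move=> Qx Qy; rewrite (svfD hQ) (svfN hQ) Qx Qy oppr0 addr0. Qed.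

Lemma gauge_Cup rho : Q (Cup T rho) = 0.
Proof.
apply: gauge_sum0 => s; apply: (svf1M_ker hQ (bideg_ginv T _ _)).
  exact: gauge_ginv.
exact: Q_C Q_gauge _.
Qed.

Lemma gauge_vielup mu m : Q (vielup T mu m) = 0.
Proof.
apply: gauge_sum0 => s; apply: (svf1M_ker hQ (bideg_ginv T _ _)).
  exact: gauge_ginv.
exact: Q_viel Q_gauge _ _.
Qed.

Lemma gauge_metric mu nu : Q (metric T mu nu) = 0.
Proof. by rewrite (svf_metric hQ) (Q_h Q_gauge) scaler0. Qed.

Lemma gauge_christoffel rho mu nu : Q (christoffel T rho mu nu) = 0.
Proof.
apply: gaugeZ0; apply: gauge_sum0 => s.
apply: (svf1M_ker hQ (bideg_ginv T _ _)); first exact: gauge_ginv.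
by apply: gaugeB0; [apply: gaugeD0|]; apply: gauge_fder0; exact: gauge_metric.
Qed.

Lemma gauge_spin_connection mu m n : Q (spin_connection T mu m n) = 0.
Proof.
apply: gauge_sum0 => nu.
apply: (svf1M_ker hQ (bideg_viel T _ _)); first exact: Q_viel Q_gauge _ _.
apply: gaugeD0; first exact/gauge_fder0/gauge_vielup.
apply: gauge_sum0 => s; apply: (svf1M_ker hQ (bideg_christoffel T _ _ _)).
  exact: gauge_christoffel.
exact: gauge_vielup.
Qed.

Lemma gauge_lorentz_C p : Q (lorentz_C p) = 0.
Proof.
have QdC mu nu : Q (fder mu (C_ T nu)) = 0.
  by apply: gauge_fder0; exact: Q_C Q_gauge _.
have hdC mu nu : in_bidegree 1 0 (fder mu (C_ T nu)).
  by apply: bideg_der; exact: bideg_C.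
apply: gaugeD0; apply: gaugeZ0.
  apply: gauge_sum0 => rho; apply: (svf1M_ker hQ (bideg_Cup T _)).
    exact: gauge_Cup.
  exact: gauge_spin_connection.
apply: gauge_sum0 => mu; apply: gauge_sum0 => nu.
have hB := bidegB (hdC mu nu) (hdC nu mu).
apply: (svf1M_ker hQ (bidegMr hB (bideg_vielup T mu p.1))); last exact: gauge_vielup.
apply: (svf1M_ker hQ hB); last exact: gauge_vielup.
exact: gaugeB0.
Qed.

(** [Q] kills the coefficients [C^rho] and commutes with derivatives; passing the odd [C^rho] gives
    the sign. *)
Lemma gauge_along_C (x : F) : Q (along_C x) = - along_C (Q x).
Proof.
rewrite (svf_sum hQ) -sumrN; apply: eq_bigr => rho _.
rewrite (svf1M_odd hQ _ (bideg_Cup T rho)) // gauge_Cup mul0r sub0r.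
by rewrite (Q_der Q_gauge).
Qed.

Lemma gauge_cE a : Q (c_ a) = (g / 2) *: ghost_action adjoint (c_ (T := T)) a.
Proof. by rewrite (Q_c Q_gauge) ghost_action_adjoint rmorphM fmorphV rmorph_nat. Qed.

Lemma gauge_AE a mu : Q (A_ a mu)
  = (xi T)^-1%:C *: fder mu (c_ a) + g *: ghost_action adjoint (fun e => A_ e mu) a.
Proof. by rewrite (Q_A Q_gauge) ghost_action_adjoint. Qed.

(** The first term is the variation of the ghost: the 1/2 in [Q c] absorbs the 2 of
    [ghost_action_twice]. *)
Lemma gauge_ghost_action n (S : gauge -> 'M[R[i]]_n) (phi : 'I_n -> F) k :
  (forall a b, mxcomm (S a) (S b) = \sum_d (str d a b)%:C *: S d) ->
  Q (ghost_action S phi k)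
  = g *: ghost_action S (ghost_action S phi) k - ghost_action S (Q \o phi) k.
Proof.
move=> hS; rewrite (svf_ghost_action _ _ _ hQ); congr (_ - _).
have two : (2 : R[i]) != 0 by rewrite pnatr_eq0.
rewrite -{1}(divfK two g) -scalerA (ghost_action_twice _ _ hS) scaler_sumr.
apply: eq_bigr => a _.
by rewrite gauge_cE ghost_action_adjoint scalerAl.
Qed.

(** Varying the ghost and varying [phi] give the same double ghost action with opposite signs. *)
Lemma gauge_square_matter n (S : gauge -> 'M[R[i]]_n) (phi : 'I_n -> F) k :
  (forall a b, mxcomm (S a) (S b) = \sum_d (str d a b)%:C *: S d) ->
  (forall l, Q (phi l) = g *: ghost_action S phi l) -> Q (Q (phi k)) = 0.
Proof.
move=> hS Qphi; rewrite Qphi (svfZ hQ) (gauge_ghost_action _ _ hS).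
rewrite (@eq_ghost_action _ _ _ S (Q \o phi) _ _ Qphi) ghost_actionZ.
by rewrite subrr scaler0.
Qed.

(** Here the two variations have different prefactors, because of the 1/2 in [Q c]; each vanishes
    separately by the Jacobi identity. *)
Lemma gauge_square_c a : Q (Q (c_ a)) = 0.
Proof.
rewrite gauge_cE (svfZ hQ) (gauge_ghost_action _ _ adjointP) ghost_action_twice_c.
rewrite (eq_ghost_action _ _ gauge_cE) ghost_actionZ ghost_action_twice_c.
by rewrite !scaler0 subr0 scaler0.
Qed.

(** The homogeneous parts cancel as for matter. The derivative of [Q c] gives the ghost action on
    [fder mu c], which cancels the inhomogeneous variation of the inner [A]. *)
Lemma gauge_square_A a mu : Q (Q (A_ a mu)) = 0.
Proof.
rewrite gauge_AE (svfD hQ) !(svfZ hQ) (Q_der Q_gauge) gauge_cE linearZ /=.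
rewrite fder_ghost_action_c (gauge_ghost_action _ _ adjointP).
have -> : ghost_action adjoint (Q \o (fun e => A_ e mu)) a
    = (xi T)^-1%:C *: ghost_action adjoint (fun e => fder mu (c_ e)) a
      + g *: ghost_action adjoint (ghost_action adjoint (fun e => A_ e mu)) a.
  rewrite -!ghost_actionZ -ghost_actionD.
  by apply: eq_ghost_action => e; exact: gauge_AE.
rewrite opprD addrCA subrr addr0 scalerN !scalerA.
by rewrite -mulrA divfK ?pnatr_eq0 // [g * _]mulrC subrr.
Qed.

Lemma gauge_square (x : F) : Q (Q x) = 0.
Proof.
have h := anticommutator_svf hQ hQ.
suff : Q (Q x) + Q (Q x) = 0.
  by rewrite -mulr2n -scaler_nat => /eqP; rewrite scaler_eq0 pnatr_eq0 => /eqP.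
have Q0 : Q 0 = 0 := svf0 hQ.
apply: (svf2_eq0 h) => [mu y|f hf].
  by rewrite !(Q_der Q_gauge) linearD.
suff -> : Q (Q (fld f)) = 0 by rewrite addr0.
case: f hf => [mu nu|mu nu|mu m|a mu|k|k|rho|a|rho|rho|a|a] hf.
- by rewrite (Q_h Q_gauge) Q0.
- by case: (hf mu nu).
- by rewrite (Q_viel Q_gauge) Q0.
- exact: gauge_square_A.
- exact: gauge_square_matter (@higgs_repP _ T) (Q_Phi Q_gauge).
- exact: gauge_square_matter (@spinor_repP _ T) (Q_Psi Q_gauge).
- by rewrite (Q_B Q_gauge) Q0.
- by rewrite (Q_b Q_gauge) Q0.
- by rewrite (Q_C Q_gauge) Q0.
- by rewrite (Q_Cbar Q_gauge) Q0.
- exact: gauge_square_c.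
- by rewrite (Q_cbar Q_gauge) (svfZ hQ) (Q_b Q_gauge) scaler0.
Qed.

End GaugeBRST.

(** * Anticommutation of the diffeomorphism and gauge operators *)

Section TotalBRST.
Context {R : realType} {T : model R} (P Q : functional T -> functional T).
Hypothesis P_diffeo : diffeomorphism_BRST P.
Hypothesis Q_gauge : gauge_BRST Q.
Local Notation F := (functional T).
Local Notation gauge := 'I_(gdim T).+1.
Local Notation g := ((gcoup T)%:C : R[i]).
Local Notation k := ((kappa T)%:C : R[i]).
Let hQ := gauge_svf Q_gauge.

Lemma diffeo_svf : super_vector_field 1 P.
Proof. exact: super_vector_field2_total (P_svf P_diffeo) _. Qed.

Let hP := diffeo_svf.

(* On every field that is a scalar under diffeomorphisms, P is kappa times the
   transport term C^rho d_rho, so that this defect vanishes there. *)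
Definition transport_defect (x : F) : F := P x + (- k) *: along_C x.
Local Notation E := transport_defect.

Lemma transport_defect_svf : super_vector_field 1 E.
Proof. exact: super_vector_field_add hP (super_vector_field_scale _ along_C_svf). Qed.

Let hE := transport_defect_svf.

(** Applied to [c], where [E] vanishes, only the extra term remains; it is needed for the
    inhomogeneous part of [Q A]. *)
Lemma transport_defect_fder mu (x : F) :
  E (fder mu x) = fder mu (E x) + k *: \sum_rho fder mu (Cup T rho) * fder rho x.
Proof.
rewrite /E (P_der P_diffeo) along_C_fder fderD [fder mu (_ *: _)]linearZ /= scalerBr.
by rewrite !scaleNr opprK addrA.
Qed.

Lemma transport_defect0 (x : F) : P x = k *: along_C x -> E x = 0.
Proof. by rewrite /E => ->; rewrite scaleNr subrr. Qed.

(* The transport term anticommutes with Q, which leaves only the defect. *)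
Lemma anticommutator_defect (x : F) : P (Q x) + Q (P x) = E (Q x) + Q (E x).
Proof.
rewrite /E (svfD hQ) (svfZ hQ) (gauge_along_C Q_gauge) scalerN.
by rewrite addrACA subrr addr0.
Qed.

Lemma defect_c a : E (c_ a) = 0.
Proof. by apply: transport_defect0; exact: P_c P_diffeo a. Qed.

Lemma defect_ghost_action n (S : gauge -> 'M[R[i]]_n) (phi : 'I_n -> F) l :
  E (ghost_action S phi l) = - ghost_action S (E \o phi) l.
Proof.
rewrite (svf_ghost_action _ _ _ hE) big1 ?sub0r // => a _.
by rewrite defect_c mul0r.
Qed.

(** Both orders yield the terms [w j] times [M j] applied to the ghost action of [phi], since
    [E c = 0], [Q (w j) = 0] and the matrices commute. The signs are opposite: one order moves [w j]
    past a ghost as well. *)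
Lemma anticommutator_matter (J : finType) (w : J -> F) n (M : J -> 'M[R[i]]_n)
    (S : gauge -> 'M[R[i]]_n) (phi : 'I_n -> F) l :
  (forall j, in_bidegree 1 0 (w j)) -> (forall j, Q (w j) = 0) ->
  (forall a j, mxcomm (S a) (M j) = 0) ->
  (forall m, Q (phi m) = g *: ghost_action S phi m) ->
  (forall m, E (phi m) = k *: \sum_j w j * matact (M j) phi m) ->
  E (Q (phi l)) + Q (E (phi l)) = 0.
Proof.
move=> hw Qw hSM Qphi Ephi.
rewrite Qphi (svfZ hE) defect_ghost_action (eq_ghost_action _ _ Ephi).
rewrite ghost_actionZ ghost_action_sum Ephi (svfZ hQ) (svf_sum hQ).
rewrite -scaleNr scalerA mulrN -mulNr mulrC -scalerA -scalerDr scaleNr.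
rewrite scaler_sumr -sumrN -big_split big1 ?scaler0 // => j _ /=.
rewrite (ghost_action_oddM _ _ _ (hw j)) //.
rewrite (ghost_action_matact _ _ (hSM^~ j)).
rewrite (svf1M_odd hQ _ (hw j)) // Qw mul0r sub0r (svf_matact hQ).
rewrite (eq_matact _ _ Qphi) matactZr scalerN opprK -scalerAr.
by rewrite subrr.
Qed.

(** The ghost action terms cancel as for matter, with [fder mu (Cup rho)] as odd coefficients. The
    terms in [fder rho c] cancel between the defect of [fder mu c] and the inhomogeneous part of
    [Q A_rho]. *)
Lemma anticommutator_A a mu : E (Q (A_ a mu)) + Q (E (A_ a mu)) = 0.
Proof.
have EA e : E (A_ e mu) = k *: \sum_rho fder mu (Cup T rho) * A_ e rho.
  by rewrite /E (P_A P_diffeo) scaleNr scalerDr addrAC subrr add0r.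
have hw rho : in_bidegree 1 0 (fder mu (Cup T rho)).
  by apply: bideg_der; exact: bideg_Cup.
rewrite (gauge_AE Q_gauge) (svfD hE) !(svfZ hE) transport_defect_fder defect_c.
rewrite linear0 add0r defect_ghost_action (eq_ghost_action _ _ EA).
rewrite ghost_actionZ ghost_action_sum EA (svfZ hQ) (svf_sum hQ).
under [X in _ + k *: X]eq_bigr => rho _.
  rewrite (svf1M_odd hQ _ (hw rho)) // (gauge_fder0 Q_gauge mu (gauge_Cup Q_gauge _)).
  rewrite mul0r sub0r (gauge_AE Q_gauge) mulrDr -!scalerAr opprD.
  over.
rewrite big_split /= !sumrN -!scaler_sumr.
under [X in - (k *: X)]eq_bigr do rewrite (ghost_action_oddM _ _ _ (hw _)) //.
rewrite sumrN !scalerDr !scalerN opprK !scalerA [k * _]mulrC [k * g]mulrC.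
by rewrite addrACA subrr subrr addr0.
Qed.

Lemma anticommutator_PQ (x : F) : P (Q x) + Q (P x) = 0.
Proof.
have h := anticommutator_svf hP hQ.
have [P0 Q0 E0] : [/\ P 0 = 0, Q 0 = 0 & E 0 = 0].
  by split; [exact: svf0 hP|exact: svf0 hQ|exact: svf0 hE].
apply: (svf2_eq0 h) => [mu y|f hf].
  by rewrite !(P_der P_diffeo, Q_der Q_gauge) linearD.
(* On a field killed by [Q], only the composite of [Q] after [P] is left to examine. *)
have Q0fld : Q (fld f) = 0 -> Q (P (fld f)) = 0 -> P (Q (fld f)) + Q (P (fld f)) = 0.
  by move=> -> ->; rewrite P0 addr0.
have Qalong (y : F) : Q y = 0 -> Q (k *: along_C y) = 0.
  by move=> Qy;
    rewrite (svfZ hQ) (gauge_along_C Q_gauge) Qy (svf0 along_C_svf) oppr0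
    scaler0.
case: f hf Q0fld => [mu nu|mu nu|mu m|a mu|l|l|rho|a|rho|rho|a|a] hf Q0fld.
- apply: Q0fld; first exact: Q_h Q_gauge _ _.
  have QdC al be : Q (fder al (C_ T be)) = 0.
    by apply: (gauge_fder0 Q_gauge); exact: Q_C Q_gauge _.
  rewrite (P_h P_diffeo); apply: (gaugeB0 Q_gauge).
    by apply: (gaugeD0 Q_gauge); apply: (gaugeZ0 Q_gauge).
  apply/(gaugeZ0 Q_gauge)/(gauge_sum0 Q_gauge) => rho.
  apply: (svf1M_ker hQ (bideg_C T rho)); first exact: Q_C Q_gauge _.
  exact: gauge_christoffel.
- by case: (hf mu nu).
- apply: Q0fld; first exact: Q_viel Q_gauge _ _.
  rewrite (P_viel P_diffeo) scalerDr; apply: (gaugeD0 Q_gauge).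
    by apply: Qalong; exact: Q_viel Q_gauge _ _.
  apply/(gaugeZ0 Q_gauge)/(gauge_sum0 Q_gauge) => rho.
  apply: (svf1M_ker hQ (bideg_der mu (bideg_Cup T rho))).
    exact/(gauge_fder0 Q_gauge)/gauge_Cup.
  exact: Q_viel Q_gauge _ _.
- by rewrite anticommutator_defect; exact: anticommutator_A.
- rewrite anticommutator_defect.
  (* The Higgs field has no rotation terms, so the index type is empty. *)
  apply: (@anticommutator_matter _ (fun _ : void => 0) _ (fun=> 0) _ _ _ _ _ _
            (Q_Phi Q_gauge)) => //.
  move=> m; rewrite big1 => [|[]]; rewrite scaler0.
  exact: transport_defect0 (P_Phi P_diffeo m).
- rewrite anticommutator_defect.
  apply: (@anticommutator_matter _ (@lorentz_C R T) _
            (fun p => sigma T p.1 p.2) _ _ _ _ _ _ (Q_Psi Q_gauge)).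
  + exact: bideg_lorentz_C.
  + exact: gauge_lorentz_C.
  + by move=> a p; exact: spinor_rep_spin.
  + move=> m; rewrite /E (P_Psi P_diffeo) kosmann_CE scalerDr scaleNr.
    by rewrite addrAC subrr add0r.
- by apply: Q0fld; rewrite ?(P_B P_diffeo) ?(Q_B Q_gauge) ?Q0.
- apply: Q0fld; first exact: Q_b Q_gauge _.
  by rewrite (P_b P_diffeo); apply: Qalong; exact: Q_b Q_gauge _.
- apply: Q0fld; first exact: Q_C Q_gauge _.
  by rewrite (P_C P_diffeo); apply: Qalong; exact: Q_C Q_gauge _.
- apply: Q0fld; first exact: Q_Cbar Q_gauge _.
  by rewrite (P_Cbar P_diffeo) (svfZ hQ) (Q_B Q_gauge) scaler0.
- rewrite anticommutator_defect (gauge_cE Q_gauge) (svfZ hE) defect_ghost_action.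
  by rewrite (eq_ghost_action _ _ defect_c) ghost_action0 defect_c Q0 oppr0 scaler0 addr0.
(* Both [cbar] and [b] transform as scalars under [P], so [E] vanishes on each. *)
- rewrite anticommutator_defect (Q_cbar Q_gauge) (svfZ hE).
  by rewrite !transport_defect0 ?Q0 ?scaler0 ?addr0 ?(P_b P_diffeo) ?(P_cbar P_diffeo).
Qed.

End TotalBRST.

Theorem theorem5p1 (R : realType) (T : model R)
    (P Q : functional T -> functional T)
    (P_diffeo : diffeomorphism_BRST P) (Q_gauge : gauge_BRST Q) :
  let D := P \+ Q in
  (forall x, supercommutator 1 1 P Q x = P (Q x) + Q (P x)) /\
  (forall x, supercommutator 1 1 P Q x = 0) /\
  super_vector_field 1 D /\
  (forall x, supercommutator 1 1 D D x = 2 *: D (D x)) /\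
  (forall x, D (D x) = P (P x)) /\
  (cohomological P -> cohomological D).
Proof.
have hP := diffeo_svf P_diffeo; have hQ := gauge_svf Q_gauge.
have sc X Y (x : functional T) : supercommutator 1 1 X Y x = X (Y x) + Y (X x).
  by rewrite /supercommutator mulr1 sgn1 scaleN1r opprK.
move=> D; have hD : super_vector_field 1 D := super_vector_field_add hP hQ.
(* The mixed terms of the expanded square form the anticommutator and [Q (Q x)] vanishes, so
   nilpotency of [D] reduces to that of [P]. *)
have DD x : D (D x) = P (P x).
  rewrite /D /= (svfD hP) (svfD hQ) (gauge_square Q_gauge) addr0 -addrA.
  by rewrite (anticommutator_PQ P_diffeo Q_gauge) addr0.
split; first exact: sc.
split; first by move=> x; rewrite sc; exact: anticommutator_PQ P_diffeo Q_gauge x.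
split; first exact: hD.
split; first by move=> x; rewrite sc scaler_nat mulr2n.
split; first exact: DD.
by case=> _ PP; split=> // x; rewrite sc DD -(sc P P) PP.
Qed.
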